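(* In the setting of the context (parameterized circuit with $D$ gates, each affected by a Pauli noise channel $\mathcal E$ of error probability $\epsilon$, with noise level $\gamma=1-(1-\epsilon)^D$), let $g_t=\nabla L(\theta^t)$, let $\hat g^{\mathrm{QEM}}_t$ be the gradient estimator based on quasi-probabilistic error mitigation with $N_c$ sampled circuits and $N_m/N_c$ measurements per sampled circuit, and let $\hat g^{\mathcal E}_t$ be the unmitigated noisy gradient estimator with $N_m$ measurements. Write $\mathrm{var}(\xi^{\mathrm{QEM}}_t)=\mathbb{E}\|\hat g_t^{\mathrm{QEM}}-g_t\|^2$ and $\mathrm{var}(\xi^{\mathcal E}_t)=\mathbb{E}\|\hat g_t^{\mathcal E}-\mathbb{E}[\hat g_t^{\mathcal E}]\|^2$. Then there are quantities $c_1(\gamma)\ge0$ and $c_2(\gamma)\ge1$ such that $$c_1(\gamma)\,\mathrm{var}(\xi^{\mathcal E}_t)\le\mathrm{var}(\xi^{\mathrm{QEM}}_t)\le V^{\mathrm{QEM}},$$ where $$V^{\mathrm{QEM}}=\frac{N_hDZ^2\operatorname{Tr}(H^2)}{2N_m}\sup_{\theta\in\mathbb{R}^D,\,y\in\{1,\dots,N_h\}}\mathbb{E}_{s^D}\bigl[\nu(p_{s^D}(y|\theta))\bigr]+\frac{Z^2D\|H\|_\infty^2}{N_c}$$ satisfies the inequality $$V^{\mathrm{QEM}}\ge c_1(\gamma)V^{\mathcal E}+\frac{c_2(\gamma)D\|H\|_\infty^2}{N_c}.$$ Furthermore, in the special case where $\mathcal E$ is the depolarizing channel, the inequality $c_1(\gamma)\ge1$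 is satisfied, and both $c_1(\gamma)$ and $c_2(\gamma)$ are non-decreasing functions of $\gamma$ with $c_1(0)=c_2(0)=1$.
   Context: Circuit. Fix $n$ qubits and $D$ parameters $\theta=(\theta_1,\dots,\theta_D)\in\mathbb{R}^D$. For each $d$, $U_d(\theta_d)=\exp(-i\frac{\theta_d}{2}G_d)$ with $G_d\in\{I,X,Y,Z\}^{\otimes n}$ a Pauli string, and $V_d$ is a fixed unitary. The noiseless gate $d$ is the channel $\mathcal U_d^{\theta_d}(\rho)=W_d\rho W_d^\dagger$ with $W_d=U_d(\theta_d)V_d$, and $|\Psi(\theta)\rangle=W_D\cdots W_1|0\rangle$. Put $\rho_0=|0\rangle\langle0|$. Observable and loss. $H=\sum_{y=1}^{N_h}h_y\Pi_y$ is a Hermitian matrix with $N_h\le2^n$ distinct eigenvalues $h_y$ and projections $\Pi_y$ onto the corresponding eigenspaces; $\langle H\rangle_\rho=\operatorname{Tr}(H\rho)$; $L(\theta)=\langle\Psi(\theta)|H|\Psi(\theta)\rangle$; $\|H\|_\infty$ is the operator norm. $\nu(x)=x(1-x)$. Noise. Each gate is followed by the Pauli channel $\mathcal E(\rho)=(1-\epsilon)\rho+\epsilon\sum_jE_j\rho E_j^\dagger$, where $0\le\epsilon\le1$, $E_j=\sqrt{p_j}\,P_{s_{j,0}}\otimes\cdots\otimes P_{s_{j,n-1}}$ with $P_0=I$, $P_1=X$, $P_2=Y$, $P_3=Z$, the sum runs over a subset of the $4^n-1$ non-identity Pauli strings, and $\sum_jp_j=1$. The depolarizing channel is the case where the $E_j$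 include all $4^n-1$ non-identity Pauli strings and $p_j=1/(4^n-1)$. The noisy state is $\rho^{\mathcal E}(\theta)=(\mathcal E\circ\mathcal U_D^{\theta_D})\circ\cdots\circ(\mathcal E\circ\mathcal U_1^{\theta_1})(\rho_0)$, and $p^{\mathcal E}(y|\theta)=\operatorname{Tr}(\Pi_y\rho^{\mathcal E}(\theta))$. Quasi-probabilistic representation. Index $n$-qubit Pauli strings by $s\in\{0,\dots,4^n-1\}$, with $s=0$ the identity, and let $\mathcal P_s(\rho)=P\rho P^\dagger$ for the string $P$ of index $s$. Each ideal gate is expressed as $\mathcal U_d^{\theta_d}=\sum_sq_{d,s}\,\mathcal O_s^{\theta_d}$ with $\mathcal O_s^{\theta_d}=\mathcal E\circ\mathcal P_s\circ\mathcal U_d^{\theta_d}$ and real quasi-probabilities $q_{d,s}$. Set $Z_d=\sum_s|q_{d,s}|$, $p_{d,s}=|q_{d,s}|/Z_d$, $Z=\prod_{d=1}^DZ_d$. For $s^D=(s_1,\dots,s_D)$, set $p_{s^D}=\prod_dp_{d,s_d}$, $\mathrm{sgn}(q_{s^D})=\prod_d\mathrm{sgn}(q_{d,s_d})$, $\rho_{s^D}(\theta)=\mathcal O^{\theta_D}_{s_D}\circ\cdots\circ\mathcal O^{\theta_1}_{s_1}(\rho_0)$, and $p_{s^D}(y|\theta)=\operatorname{Tr}(\Pi_y\rho_{s^D}(\theta))$. $\mathbb{E}_{s^D}$ denotes expectation over $s^D$ drawn from the distribution $p_{s^D}$. Estimators. For a state $\rho$, $\widehat{\langle H\rangle}_\rho$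 with $N$ shots is the mean of $N$ i.i.d. outcomes of measuring $H$ in $\rho$ (outcome $h_y$ with probability $\operatorname{Tr}(\Pi_y\rho)$). Let $e_d$ be the $d$-th standard basis vector. - Unmitigated: $[\hat g^{\mathcal E}_t]_d=\frac12\bigl(\widehat{\langle H\rangle}_{\rho^{\mathcal E}(\theta^t+\frac\pi2e_d)}-\widehat{\langle H\rangle}_{\rho^{\mathcal E}(\theta^t-\frac\pi2e_d)}\bigr)$, independent empirical averages with $N_m$ shots each. - Mitigated: sample $s^D_1,\dots,s^D_{N_c}$ i.i.d. from $p_{s^D}$ and set $[\hat g_t^{\mathrm{QEM}}]_d=\frac{Z}{N_c}\sum_{l=1}^{N_c}\mathrm{sgn}(q_{s^D_l})\cdot\frac12\bigl(\widehat{\langle H\rangle}_{\rho_{s^D_l}(\theta^t+\frac\pi2e_d)}-\widehat{\langle H\rangle}_{\rho_{s^D_l}(\theta^t-\frac\pi2e_d)}\bigr)$, with $N_m/N_c$ shots for each empirical average, independent conditionally on the sampled circuits. For the mitigated estimator, expectations are over both the measurements and the sampled circuits. Finally, $V^{\mathcal E}=\frac{DN_h\operatorname{Tr}(H^2)}{2N_m}\max_{y\in\{1,\dots,N_h\}}\max_{\theta\in\mathbb{R}^D}\nu(p^{\mathcal E}(y|\theta))$. *)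

(* Defs.v *)
From HB Require Import structures.
From mathcomp Require Import all_boot all_order all_algebra.
From mathcomp Require Import complex mxtens.
From mathcomp Require Import all_classical all_reals all_analysis.

Set Implicit Arguments.
Unset Strict Implicit.
Unset Printing Implicit Defensive.

Import Order.TTheory GRing.Theory Num.Theory.
Import numFieldNormedType.Exports.
Local Open Scope classical_set_scope.
Local Open Scope ring_scope.
Local Open Scope complex_scope.
Local Open Scope sesquilinear_scope.

Section LinearAlgebra.
Context {R : realType}.

(* Exponential series, summed entrywise (real and imaginary parts). *)
Definition expmx {m} (A : 'M[R[i]]_m) : 'M[R[i]]_m :=
  let S k := \sum_(j < k) (j`!%:R)^-1 *: A ^+ j in
  \matrix_(a, b) Complex (limn (fun k => complex.Re (S k a b)))
                         (limn (fun k => complex.Im (S k a b))).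

Definition norm2 {m} (v : 'cV[R[i]]_m) : R :=
  Num.sqrt (complex.Re ((v^t* *m v) 0 0)).

Definition opnorm {m} (A : 'M[R[i]]_m) : R :=
  sup [set norm2 (A *m v) | v in [set v : 'cV[R[i]]_m | norm2 v = 1]].

(* A_0 (x) A_1 (x) ... (x) A_(n-1) *)
Fixpoint tensor_rec k (A : nat -> 'M[R[i]]_2) : 'M[R[i]]_(2 ^ k.+1) :=
  if k is k'.+1 then A 0%N *t tensor_rec k' (fun i => A i.+1) else A 0%N.

Definition tensor n (A : nat -> 'M[R[i]]_2) : 'M[R[i]]_(2 ^ n) :=
  if n is k.+1 return 'M[R[i]]_(2 ^ n) then tensor_rec k A else 1%:M.

Definition pauliX : 'M[R[i]]_2 := \matrix_(i, j) (i != j)%:R.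
Definition pauliY : 'M[R[i]]_2 :=
  \matrix_(i, j) (if i == j then 0 else if i == 0 then - 'i else 'i).
Definition pauliZ : 'M[R[i]]_2 := \matrix_(i, j) ((-1) ^+ i *+ (i == j)).

Definition pauli1 (k : 'I_4) : 'M[R[i]]_2 :=
  match val k with
  | 0%N => 1%:M | 1%N => pauliX | 2%N => pauliY | _ => pauliZ
  end.

End LinearAlgebra.

(* The base-4 digits of the index of a Pauli string; 0, 1, 2, 3 stand for
   I, X, Y, Z. *)
Definition pauli_index n := n.-tuple 'I_4.

Definition pauli_id n : pauli_index n := nseq_tuple n ord0.

Definition pauli {R : realType} {n} (s : pauli_index n) : 'M[R[i]]_(2 ^ n) :=
  tensor n (fun k => pauli1 (nth ord0 s k)).

Definition dagger_conj {R : realType} {m} (A rho : 'M[R[i]]_m) : 'M[R[i]]_m :=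
  A *m rho *m A^t*.

Record circuit (R : realType) (n D : nat) := Circuit {
  generator : 'I_D -> pauli_index n;
  fixed_gate : 'I_D -> 'M[R[i]]_(2 ^ n);
  fixed_gate_unitary : forall d, fixed_gate d \is unitarymx
}.

(* The E_j range over the strings in [noise_supp], with p_j = noise_prob j. *)
Record pauli_noise (R : realType) (n : nat) := PauliNoise {
  noise_supp : {set pauli_index n};
  noise_prob : pauli_index n -> R;
  noise_supp_nonid : pauli_id n \notin noise_supp;
  noise_prob_ge0 : forall s, s \in noise_supp -> 0 <= noise_prob s;
  noise_prob_sum1 : \sum_(s in noise_supp) noise_prob s = 1
}.

Definition depolarizing {R : realType} {n} (ns : pauli_noise R n) : Prop :=
  noise_supp ns = [set s | s != pauli_id n]%SET /\
  (forall s, s \in noise_supp ns -> noise_prob ns s = (4 ^+ n - 1)^-1).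

(* [obs_proj y] is the orthogonal projection onto the eigenspace of the
   eigenvalue [obs_val y]. *)
Record observable (R : realType) (n Nh : nat) := Observable {
  obs_mx : 'M[R[i]]_(2 ^ n);
  obs_val : 'I_Nh -> R;
  obs_proj : 'I_Nh -> 'M[R[i]]_(2 ^ n);
  obs_herm : obs_mx \is hermsymmx;
  obs_val_inj : injective obs_val;
  obs_val_eigen : forall a, eigenvalue obs_mx a <-> exists y, a = (obs_val y)%:C;
  obs_proj_herm : forall y, obs_proj y \is hermsymmx;
  obs_proj_idem : forall y, obs_proj y *m obs_proj y = obs_proj y;
  obs_proj_range : forall y (v : 'cV_(2 ^ n)),
    obs_proj y *m v = v <-> obs_mx *m v = (obs_val y)%:C *: v;
  obs_decomp : obs_mx = \sum_y (obs_val y)%:C *: obs_proj y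
}.

Section Circuits.
Context {R : realType} {n D : nat}.
Implicit Types (C : circuit R n D) (ns : pauli_noise R n) (eps : R).
Implicit Types (theta : 'rV[R]_D) (rho : 'M[R[i]]_(2 ^ n)).

Definition gate C (d : 'I_D) (t : R) : 'M[R[i]]_(2 ^ n) :=
  expmx ((- 'i * (t / 2)%:C) *: pauli (generator C d)) *m fixed_gate C d.

Definition gate_channel C (d : 'I_D) (t : R) rho := dagger_conj (gate C d t) rho.

Definition ket0 : 'cV[R[i]]_(2 ^ n) := \col_i (val i == 0%N)%:R.
Definition rho0 : 'M[R[i]]_(2 ^ n) := ket0 *m ket0^t*.

(* [enum 'I_D] is increasing, so gate number 0 is applied first. *)
Definition psi C theta : 'cV[R[i]]_(2 ^ n) :=
  foldl (fun v d => gate C d (theta 0 d) *m v) ket0 (enum 'I_D).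

Definition loss Nh C (H : observable R n Nh) theta : R :=
  complex.Re (((psi C theta)^t* *m obs_mx H *m psi C theta) 0 0).

Definition gradient (f : 'rV[R]_D -> R) theta : 'rV[R]_D :=
  \row_d 'D_(delta_mx 0 d) f theta.

Definition noise_op ns (s : pauli_index n) : 'M[R[i]]_(2 ^ n) :=
  (Num.sqrt (noise_prob ns s))%:C *: pauli s.

Definition noise_channel ns eps rho :=
  (1 - eps)%:C *: rho
  + eps%:C *: \sum_(s in noise_supp ns) dagger_conj (noise_op ns s) rho.

Definition noisy_state ns eps C theta :=
  foldl (fun rho d => noise_channel ns eps (gate_channel C d (theta 0 d) rho))
        rho0 (enum 'I_D).

Definition noise_level eps : R := 1 - (1 - eps) ^+ D.

(* Born rule. The trace is real for a Hermitian [rho]. *)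
Definition outcome_prob Nh (H : observable R n Nh) rho (y : 'I_Nh) : R :=
  complex.Re (\tr (obs_proj H y *m rho)).

(* O_s^{theta_d} *)
Definition noisy_op ns eps C (d : 'I_D) (t : R) (s : pauli_index n) rho :=
  noise_channel ns eps (dagger_conj (pauli s) (gate_channel C d t rho)).

Implicit Type q : 'I_D -> pauli_index n -> R.

Definition quasi_prob_repr ns eps C q : Prop :=
  forall (d : 'I_D) (t : R) rho,
    gate_channel C d t rho = \sum_s (q d s)%:C *: noisy_op ns eps C d t s rho.

Definition qZ1 q (d : 'I_D) : R := \sum_s `|q d s|.
Definition qZ q : R := \prod_d qZ1 q d.

Definition circuit_sample := {ffun 'I_D -> pauli_index n}.

Definition sample_prob q (s : circuit_sample) : R :=
  \prod_d (`|q d (s d)| / qZ1 q d).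
Definition sample_sgn q (s : circuit_sample) : R :=
  \prod_d Num.sg (q d (s d)).
Definition sample_state ns eps C (s : circuit_sample) theta :=
  foldl (fun rho d => noisy_op ns eps C d (theta 0 d) (s d) rho)
        rho0 (enum 'I_D).

End Circuits.

(* Expectation of [X] on a finite sample space with probability mass [w]. *)
Definition expect {R : realType} (Omega : finType) (w X : Omega -> R) : R :=
  \sum_o w o * X o.

Definition sqnorm {R : realType} {D} (v : 'rV[R]_D) : R := \sum_d v 0 d ^+ 2.

Definition nu {R : realType} (x : R) : R := x * (1 - x).

(* theta + (pi/2) e_d for [b = true], theta - (pi/2) e_d for [b = false]. *)
Definition shift {R : realType} {D} (theta : 'rV[R]_D) (d : 'I_D) (b : bool) :
    'rV[R]_D :=
  theta + (if b then pi / 2 else - (pi / 2)) *: delta_mx 0 d.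

Section Estimators.
Context {R : realType} {n D Nh : nat}.
Variables (ns : pauli_noise R n) (eps : R) (C : circuit R n D).
Variables (H : observable R n Nh) (theta : 'rV[R]_D).

(* The sample spaces below record the raw measurement outcomes; the index
   (d, b, k) is the k-th shot at parameters [shift theta d b]. *)

Definition empirical_mean {N} (o : 'I_N -> 'I_Nh) : R :=
  N%:R^-1 * \sum_k obs_val H (o k).

Definition noisy_outcomes Nm := {ffun 'I_D * bool * 'I_Nm -> 'I_Nh}.

Definition noisy_law {Nm} (o : noisy_outcomes Nm) : R :=
  \prod_i outcome_prob H (noisy_state ns eps C (shift theta i.1.1 i.1.2)) (o i).

Definition noisy_grad {Nm} (o : noisy_outcomes Nm) : 'rV[R]_D :=
  \row_d (2^-1 * (empirical_mean (fun k => o (d, true, k))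
                  - empirical_mean (fun k => o (d, false, k)))).

Definition noisy_grad_mean Nm : 'rV[R]_D :=
  \row_d expect (@noisy_law Nm) (fun o => noisy_grad o 0 d).

(* var(xi^E) *)
Definition noisy_var Nm : R :=
  expect (@noisy_law Nm) (fun o => sqnorm (noisy_grad o - noisy_grad_mean Nm)).

Variable q : 'I_D -> pauli_index n -> R.

(* The Nc sampled circuits, then the outcomes of M shots for each sampled
   circuit l, each component d and each sign b. *)
Definition qem_outcomes Nc M : Type :=
  {ffun 'I_Nc -> @circuit_sample n D} *
  {ffun 'I_Nc * 'I_D * bool * 'I_M -> 'I_Nh}.

Definition qem_law {Nc M} (o : qem_outcomes Nc M) : R :=
  (\prod_l sample_prob q (o.1 l)) *
  \prod_(i : 'I_Nc * 'I_D * bool * 'I_M)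
    outcome_prob H
      (sample_state ns eps C (o.1 i.1.1.1) (shift theta i.1.1.2 i.1.2)) (o.2 i).

Definition qem_grad {Nc M} (o : qem_outcomes Nc M) : 'rV[R]_D :=
  \row_d (qZ q / Nc%:R *
    \sum_l sample_sgn q (o.1 l) *
      (2^-1 * (empirical_mean (fun k => o.2 (l, d, true, k))
               - empirical_mean (fun k => o.2 (l, d, false, k))))).

(* var(xi^QEM): the deviation is taken from the exact gradient. *)
Definition qem_var Nc M : R :=
  expect (@qem_law Nc M)
    (fun o => sqnorm (qem_grad o - gradient (loss C H) theta)).

(* Tr(H^2) *)
Definition obs_tr2 : R := complex.Re (\tr (obs_mx H *m obs_mx H)).

(* The map theta |-> nu(p(y|theta)) is continuous and periodic in each
   coordinate, so its maximum over R^D is this supremum; nu(p) >= 0, so the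
   base value 0 of the finite maximum is harmless. *)
Definition V_noisy (Nm : nat) : R :=
  D%:R * Nh%:R * obs_tr2 / (2 * Nm%:R) *
  \big[Num.max/0]_(y < Nh)
    sup [set nu (outcome_prob H (noisy_state ns eps C th) y) | th in setT].

Definition V_qem (Nm Nc : nat) : R :=
  Nh%:R * D%:R * qZ q ^+ 2 * obs_tr2 / (2 * Nm%:R) *
    sup [set expect (sample_prob q)
           (fun s => nu (outcome_prob H (sample_state ns eps C s thy.1) thy.2))
         | thy in [set: 'rV[R]_D * 'I_Nh]]
  + qZ q ^+ 2 * D%:R * opnorm (obs_mx H) ^+ 2 / Nc%:R.

End Estimators.

(* Main.v *)
(* Conditionally on the sampled circuits, only the shots fluctuate, so the
   variance of each component of the mitigated estimator splits into a shot part
   [Z^2 / (4 Nm) * E_s (Var_+ + Var_-)] and a circuit part, which is [1 / Nc]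
   times the variance of [Z sgn(q_s) (<H>_+ - <H>_-) / 2], hence at most
   [Z^2 |H|^2 / Nc].  There is no bias: expanding the product of the gate
   representations gives [sum_s q_s rho_s = |psi><psi|], and the
   parameter-shift rule computes the gradient of the loss exactly.  The shot part
   is bounded by [Var <= Nh sum_y h_y^2 nu(p_y)] (Cauchy-Schwarz) and
   [sum_y h_y^2 <= Tr H^2].

   In general [c1 = 0] and [c2 = 1] suffice, since [sum_s q_{d,s} = 1] (trace
   preservation) forces [Z >= 1].  For the depolarizing channel the constants
   [c1 = c2 = 1] do: there [|q_{d,0}| >= 1], so the sample made of identity
   strings, whose state is the noisy state, satisfies [Z^2 p_0 >= Z >= 1], and
   every nonnegative quantity at the noisy state is at most [Z^2] times its mean
   over the samples. *)
Require Import Defs.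
From HB Require Import structures.
From mathcomp Require Import all_boot all_order all_algebra.
From mathcomp Require Import complex mxtens.
From mathcomp Require Import all_classical all_reals all_analysis.
From mathcomp Require Import ring lra.

Set Implicit Arguments.
Unset Strict Implicit.
Unset Printing Implicit Defensive.

Import Order.TTheory GRing.Theory Num.Theory.
Import numFieldNormedType.Exports.
Local Open Scope classical_set_scope.
Local Open Scope ring_scope.
Local Open Scope complex_scope.
Local Open Scope sesquilinear_scope.

(** * Adjoints, Hermitian matrices and complex conjugation *)

Lemma adjmxM (K : numClosedFieldType) m n p (A : 'M[K]_(m, n)) (B : 'M[K]_(n, p)) :
  (A *m B)^t* = B^t* *m A^t*.
Proof. by rewrite trmx_mul map_mxM. Qed.

Lemma adjmxZ (K : numClosedFieldType) m n (a : K) (A : 'M[K]_(m, n)) :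
  (a *: A)^t* = Num.conj a *: A^t*.
Proof. by rewrite linearZ /= map_mxZ. Qed.

Lemma adjmxD (K : numClosedFieldType) m n (A B : 'M[K]_(m, n)) :
  (A + B)^t* = A^t* + B^t*.
Proof. by rewrite linearD /= map_mxD. Qed.

Lemma adjmxB (K : numClosedFieldType) m n (A B : 'M[K]_(m, n)) :
  (A - B)^t* = A^t* - B^t*.
Proof. by rewrite linearB /= map_mxB. Qed.

Lemma adjmx_sum (K : numClosedFieldType) m n (I : finType) (A : I -> 'M[K]_(m, n)) :
  (\sum_i A i)^t* = \sum_i (A i)^t*.
Proof. by rewrite linear_sum /= raddf_sum. Qed.

Lemma adjmx1 (K : numClosedFieldType) n : (1%:M : 'M[K]_n)^t* = 1%:M.
Proof. by rewrite trmx1 map_mx1. Qed.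

Lemma hermP (K : numClosedFieldType) n (A : 'M[K]_n) :
  reflect (A^t* = A) (A \is hermsymmx).
Proof.
by apply: (iffP (is_hermitianmxP _ _ _)); rewrite expr0 scale1r => /esym.
Qed.

Lemma conjE (R : realType) (x : R[i]) : Num.conj x = conjc x.
Proof. by []. Qed.

Lemma imaginaryE (R : realType) : Num.imaginary = Complex 0 1 :> R[i].
Proof. by []. Qed.

Lemma conj_real (R : realType) (a : R) : Num.conj a%:C = a%:C :> R[i].
Proof. by rewrite conjE conjc_real. Qed.

(** * Pauli strings *)

Section Tensor.
Context {R : realType}.
Implicit Types A B : nat -> 'M[R[i]]_2.

Lemma mxtrace_tens m p (M : 'M[R[i]]_m) (N : 'M[R[i]]_p) :
  \tr (M *t N) = \tr M * \tr N.
Proof.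
rewrite /mxtrace big_distrlr /= pair_bigA /=.
rewrite (reindex (@mxtens_index m p)) /=; last first.
  by exists (@mxtens_unindex m p) => ? _; rewrite (mxtens_indexK, mxtens_unindexK).
by apply: eq_bigr => -[i j] _; rewrite tensmxE.
Qed.

Lemma tens_1mx m p : (1%:M : 'M[R[i]]_m) *t (1%:M : 'M[R[i]]_p) = 1%:M.
Proof.
apply/matrixP => i j.
case: (mxtens_indexP i) => i1 i2; case: (mxtens_indexP j) => j1 j2.
by rewrite tensmxE !mxE -natrM mulnb (can_eq (@mxtens_indexK _ _)).
Qed.

Lemma tensor_mul n A B :
  tensor n A *m tensor n B = tensor n (fun k => A k *m B k).
Proof.
case: n => [|n] /=; first by rewrite mul1mx.
elim: n A B => [|n IH] A B //=.
by have := tensmx_mul; rewrite /= => ->; rewrite IH.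
Qed.

Lemma tensor_adj n A : (tensor n A)^t* = tensor n (fun k => (A k)^t*).
Proof.
case: n => [|n] /=; first by rewrite adjmx1.
elim: n A => [|n IH] A //=.
rewrite -IH trmx_tens.
apply/matrixP => i j; by rewrite !mxE rmorphM.
Qed.

Lemma tensor1 n : tensor n (fun=> 1%:M) = 1%:M :> 'M[R[i]]_(2 ^ n).
Proof.
case: n => [|n] //=; elim: n => [|n IH] //=.
by rewrite IH; exact: tens_1mx.
Qed.

Lemma tensor_tr n A : \tr (tensor n A) = \prod_(k < n) \tr (A k).
Proof.
case: n => [|n] /=; first by rewrite mxtrace1 big_ord0.
elim: n A => [|n IH] A /=; first by rewrite big_ord_recl big_ord0 mulr1.
by rewrite big_ord_recl mxtrace_tens IH.
Qed.

End Tensor.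

Section Pauli.
Context {R : realType}.

Lemma pauli1_adj (k : 'I_4) : (pauli1 k)^t* = pauli1 k :> 'M[R[i]]_2.
Proof.
apply/matrixP => i j; rewrite !mxE conjE.
case: k => [[|[|[|[|//]]]] ?]; rewrite /pauli1 /= !mxE ?imaginaryE;
  case: i => [[|[|//]] ?]; case: j => [[|[|//]] ?]; apply/eqP;
  by rewrite eq_complex /= ?oppr0 ?opprK ?eqxx.
Qed.

Lemma pauli1_sqr (k : 'I_4) : pauli1 k *m pauli1 k = 1%:M :> 'M[R[i]]_2.
Proof.
apply/matrixP => i j; rewrite !mxE !big_ord_recl big_ord0 /=.
case: k => [[|[|[|[|//]]]] ?]; rewrite /pauli1 /= !mxE ?imaginaryE;
  case: i => [[|[|//]] ?]; case: j => [[|[|//]] ?]; apply/eqP;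
  rewrite eq_complex /= ?(mulr0, mul0r, mulr1, mul1r, oppr0, addr0, add0r, subr0,
    sub0r, opprK, mulNr, mulrN, expr0, expr1) //;
  rewrite ?eqxx //.
Qed.

Lemma pauli1_tr (k l : 'I_4) :
  \tr (pauli1 k *m pauli1 l) = (2 *+ (k == l))%:C :> R[i].
Proof.
rewrite /mxtrace !big_ord_recl big_ord0 /= !mxE !big_ord_recl !big_ord0 /=.
case: k => [[|[|[|[|//]]]] ?]; case: l => [[|[|[|[|//]]]] ?];
  rewrite /pauli1 /= !mxE ?imaginaryE; apply/eqP;
  rewrite eq_complex /= ?(mulr0, mul0r, mulr1, mul1r, oppr0, addr0, add0r, subr0,
    sub0r, opprK, mulNr, mulrN, expr0, expr1) //;
  rewrite ?eqxx ?subrr ?addNr ?eqxx ?mulr0n ?eqxx //.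
Qed.

Context {n : nat}.
Implicit Types s r : pauli_index n.

Lemma pauli_adj s : (pauli s)^t* = pauli s :> 'M[R[i]]_(2 ^ n).
Proof.
rewrite /pauli tensor_adj; congr tensor.
by apply/funext => k; rewrite pauli1_adj.
Qed.

Lemma pauli_sqr s : pauli s *m pauli s = 1%:M :> 'M[R[i]]_(2 ^ n).
Proof.
rewrite /pauli tensor_mul -tensor1; congr tensor.
by apply/funext => k; rewrite pauli1_sqr.
Qed.

Lemma pauli_id1 : pauli (pauli_id n) = 1%:M :> 'M[R[i]]_(2 ^ n).
Proof.
rewrite /pauli -tensor1; congr tensor.
by apply/funext => k; rewrite nth_nseq if_same.
Qed.

(** Orthogonality of Pauli strings. The trace of a tensor product is the product of the traces, so
    one position where the strings differ makes it vanish. *)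
Lemma pauli_tr r s :
  \tr (pauli r *m pauli s) = (2 ^+ n *+ (r == s))%:C :> R[i].
Proof.
rewrite /pauli tensor_mul tensor_tr.
under eq_bigr => k _ do rewrite pauli1_tr -!tnth_nth.
case: eqVneq => [->|rs].
  under eq_bigr => k _ do rewrite eqxx mulr1n.
  by rewrite prodr_const card_ord mulr1n rmorphXn.
have [k rsk] : exists k, tnth r k != tnth s k.
  apply/existsP; rewrite -[X in is_true X]negbK negb_exists; apply: contra rs.
  by move=> /forallP rs; apply/eqP/eq_from_tnth => k; apply/eqP;
    rewrite -[_ == _]negbK.
by rewrite (bigD1 k) //= (negbTE rsk) !mulr0n mul0r.
Qed.

Lemma pauli_unitary s : pauli s \is @unitarymx R[i] (2 ^ n) (2 ^ n).
Proof. by apply/unitarymxP; rewrite pauli_adj pauli_sqr. Qed.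

End Pauli.

(** * States and observables *)

Section DaggerConj.
Context {R : realType} {m : nat}.
Implicit Types A B rho : 'M[R[i]]_m.

Lemma dagger_conj_is_linear A : linear (dagger_conj A).
Proof.
move=> a rho sigma; rewrite /dagger_conj mulmxDr mulmxDl.
by rewrite -scalemxAr -scalemxAl.
Qed.

HB.instance Definition _ A :=
  GRing.isLinear.Build R[i] 'M[R[i]]_m 'M[R[i]]_m _
    (dagger_conj A) (dagger_conj_is_linear A).

Lemma dagger_conj1 rho : dagger_conj 1%:M rho = rho.
Proof. by rewrite /dagger_conj adjmx1 mul1mx mulmx1. Qed.

Lemma dagger_conjM A B rho :
  dagger_conj A (dagger_conj B rho) = dagger_conj (A *m B) rho.
Proof. by rewrite /dagger_conj adjmxM !mulmxA. Qed.

Lemma dagger_conjZ (a : R) A rho :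
  dagger_conj (a%:C *: A) rho = (a ^+ 2)%:C *: dagger_conj A rho.
Proof.
rewrite /dagger_conj adjmxZ conj_real -!scalemxAl -!scalemxAr scalerA.
by rewrite rmorphXn expr2.
Qed.

Lemma unitarymxC A : A \is unitarymx -> A^t* *m A = 1%:M.
Proof. by move=> /unitarymxP /mulmx1C. Qed.

Lemma mxtrace_dagger_conj A rho :
  A \is unitarymx -> \tr (dagger_conj A rho) = \tr rho.
Proof.
by move=> /unitarymxC uA; rewrite /dagger_conj mxtrace_mulC mulmxA uA mul1mx.
Qed.

(** The left side is the trace of the map [rho |-> A rho A^*] on the space of matrices. Being linear
    in the map, it will later isolate single Pauli coefficients of a channel. *)
Lemma supertrace_dagger_conj A :
  \sum_i \sum_j dagger_conj A (delta_mx i j) i j = \tr A * Num.conj (\tr A).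
Proof.
rewrite /mxtrace rmorph_sum /= big_distrlr /=.
apply: eq_bigr => i _; apply: eq_bigr => j _.
rewrite /dagger_conj mxE (bigD1 j) //= [X in _ + X]big1 ?addr0.
  rewrite !mxE (bigD1 i) //= [X in _ + X]big1 ?addr0 ?mxE ?eqxx ?mulr1 //.
  by move=> k ki; rewrite mxE (negbTE ki) mulr0.
move=> k kj; rewrite mxE big1 ?mul0r // => l _.
by rewrite mxE (negbTE kj) andbF mulr0.
Qed.

End DaggerConj.

Lemma Re_sum (R : realType) (I : Type) (r : seq I) (Q : pred I) (F : I -> R[i]) :
  complex.Re (\sum_(i <- r | Q i) F i) = \sum_(i <- r | Q i) complex.Re (F i).
Proof. by apply: (big_morph (@complex.Re R)) => // -[a b] [c d]. Qed.

Lemma Re_realM (R : realType) (a : R) (z : R[i]) :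
  complex.Re (a%:C * z) = a * complex.Re z.
Proof. by case: z => b c /=; rewrite mul0r subr0. Qed.

Lemma Re_mxtrace_sum (R : realType) m (I : finType) (F : I -> 'M[R[i]]_m) :
  complex.Re (\tr (\sum_i F i)) = \sum_i complex.Re (\tr (F i)).
Proof. by rewrite (raddf_sum (@mxtrace R[i] m)) Re_sum. Qed.

Section States.
Context {R : realType} {m : nat}.
Implicit Types (A B P rho : 'M[R[i]]_m).

(** Positivity is stated through all conjugations: it is then stable under unitary channels at once,
    and taking [B] to be a projection gives nonnegative Born probabilities. *)
Definition density rho :=
  \tr rho = 1 /\ forall B, 0 <= \tr (dagger_conj B rho).

Lemma mxtrace_gram_ge0 p (v : 'M[R[i]]_(m, p)) : 0 <= \tr (v *m v^t*).
Proof.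
apply: sumr_ge0 => i _; rewrite mxE sumr_ge0 // => j _.
by rewrite !mxE mul_conjC_ge0.
Qed.

Lemma density_pure (v : 'cV[R[i]]_m) :
  (v^t* *m v) 0 0 = 1 -> density (v *m v^t*).
Proof.
move=> v1; split; first by rewrite mxtrace_mulC trace_mx11.
move=> B; rewrite /dagger_conj mulmxA -mulmxA -adjmxM.
exact: mxtrace_gram_ge0.
Qed.

Lemma density_dagger_conj A rho :
  A \is unitarymx -> density rho -> density (dagger_conj A rho).
Proof.
move=> uA [tr1 rho_ge0]; split; first by rewrite mxtrace_dagger_conj.
by move=> B; rewrite dagger_conjM.
Qed.

Lemma density_convex (I : finType) (w : I -> R) (rho : I -> 'M[R[i]]_m) :
    (forall i, 0 <= w i) -> \sum_i w i = 1 -> (forall i, density (rho i)) ->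
  density (\sum_i (w i)%:C *: rho i).
Proof.
move=> w0 w1 rhoP; split.
  rewrite raddf_sum /= -[RHS](rmorph1 (real_complex R)) -w1 rmorph_sum /=.
  by apply: eq_bigr => i _; rewrite mxtraceZ (rhoP i).1 mulr1.
move=> B; rewrite linear_sum raddf_sum /= sumr_ge0 // => i _.
by rewrite linearZ /= mxtraceZ mulr_ge0 ?ler0c ?(rhoP i).2.
Qed.

Definition expval A rho : R := complex.Re (\tr (A *m rho)).

Lemma expval_sum (I : finType) A (w : I -> R) (rho : I -> 'M[R[i]]_m) :
  expval A (\sum_i (w i)%:C *: rho i) = \sum_i w i * expval A (rho i).
Proof.
rewrite /expval mulmx_sumr Re_mxtrace_sum; apply: eq_bigr => i _.
by rewrite -scalemxAr /= mxtraceZ Re_realM.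
Qed.

Lemma mxtrace_proj_ge0 P rho :
  P^t* = P -> P *m P = P -> density rho -> 0 <= \tr (P *m rho).
Proof.
move=> PC PP [_ /(_ P)].
by rewrite /dagger_conj PC mxtrace_mulC mulmxA PP.
Qed.

Lemma Re_ge0 (z : R[i]) : 0 <= z -> 0 <= complex.Re z.
Proof. by rewrite lecE => /andP[]. Qed.

Lemma expval_proj_ge0 P rho :
  P^t* = P -> P *m P = P -> density rho -> 0 <= expval P rho.
Proof. by move=> PC PP rhoP; exact/Re_ge0/mxtrace_proj_ge0. Qed.

End States.

Lemma col_mulmx (K : pzRingType) m p r (A : 'M[K]_(m, p)) (B : 'M[K]_(p, r)) j :
  col j (A *m B) = A *m col j B.
Proof. by rewrite !colE mulmxA. Qed.

Section Observable.
Context {R : realType} {n Nh : nat} (H : observable R n Nh).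
Local Notation h := (obs_val H).
Local Notation P := (obs_proj H).

Lemma obs_projC y : (P y)^t* = P y.
Proof. exact/hermP/obs_proj_herm. Qed.

Lemma obs_mxC : (obs_mx H)^t* = obs_mx H.
Proof. exact/hermP/obs_herm. Qed.

Lemma mulmx_obs_proj y : obs_mx H *m P y = (h y)%:C *: P y.
Proof.
apply/matrixP => i j.
have /(congr1 (fun v : 'cV[R[i]]_(2 ^ n) => v i 0)) :
  obs_mx H *m col j (P y) = (h y)%:C *: col j (P y).
  by apply/obs_proj_range; rewrite -col_mulmx obs_proj_idem.
by rewrite -col_mulmx !mxE.
Qed.

Lemma mul_proj_obs_mx y : P y *m obs_mx H = (h y)%:C *: P y.
Proof.
have /(congr1 (fun A : 'M[R[i]]_(2 ^ n) => A^t*)) := mulmx_obs_proj y.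
by rewrite adjmxM adjmxZ conj_real obs_projC obs_mxC.
Qed.

(** Letting the observable act on either side of [P y *m P z] multiplies it by [h y] or by [h z],
    and these eigenvalues differ. *)
Lemma obs_proj_orth y z : y != z -> P y *m P z = 0.
Proof.
move=> yz; have : (h y)%:C *: (P y *m P z) = (h z)%:C *: (P y *m P z).
  by rewrite scalemxAl -mul_proj_obs_mx -mulmxA mulmx_obs_proj -scalemxAr.
move=> /eqP; rewrite -subr_eq0 -scalerBl scaler_eq0 subr_eq0 => /orP[|/eqP //].
by move=> /eqP/complexI/obs_val_inj yz'; rewrite yz' eqxx in yz.
Qed.

Lemma mul_proj_sum y : P y *m \sum_z P z = P y.
Proof.
rewrite mulmx_sumr (bigD1 y) //= obs_proj_idem big1 ?addr0 // => z zy.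
by rewrite obs_proj_orth // eq_sym.
Qed.

(* The complement of the sum is a projection annihilated by [obs_mx H], so if
   it were nonzero, then 0 would be an eigenvalue and its range would lie in
   the range of the corresponding projection. *)
Lemma sum_obs_proj : \sum_y P y = 1%:M.
Proof.
apply/eqP; rewrite eq_sym -subr_eq0; set Q := _ - _.
have PQ y : P y *m Q = 0 by rewrite mulmxBr mulmx1 mul_proj_sum subrr.
have QC : Q^t* = Q.
  by rewrite adjmxB adjmx1 adjmx_sum; under eq_bigr do rewrite obs_projC.
have HQ : obs_mx H *m Q = 0.
  rewrite obs_decomp mulmx_suml big1 // => y _.
  by rewrite -scalemxAl PQ scaler0.
have QH : Q *m obs_mx H = 0.
  by rewrite -[LHS](trmxCK) adjmxM obs_mxC QC HQ trmx0 map_mx0.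
apply/negPn/negP => /eqP Q0.
have [i Qi] : exists i, row i Q != 0.
  apply/existsP; rewrite -[X in is_true X]negbK negb_exists.
  apply/negP => /forallP Qi; apply: Q0; apply/row_matrixP => i.
  by apply/eqP; rewrite row0 -[_ == _]negbK.
have /obs_val_eigen[y y0] : eigenvalue (obs_mx H) 0.
  by apply/eigenvalueP; exists (row i Q) => //; rewrite -row_mul QH row0 scale0r.
apply: Q0; rewrite -(PQ y); apply/matrixP => k j.
have /(congr1 (fun v : 'cV[R[i]]_(2 ^ n) => v k 0)) : P y *m col j Q = col j Q.
  apply/obs_proj_range; rewrite -y0 scale0r -col_mulmx HQ.
  by apply/matrixP => ? ?; rewrite !mxE.
by rewrite -col_mulmx [LHS]mxE [RHS]mxE => ->.
Qed.

Lemma outcome_prob_ge0 rho y : density rho -> 0 <= outcome_prob H rho y.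
Proof. exact: expval_proj_ge0 (obs_projC y) (obs_proj_idem H y). Qed.

Lemma sum_outcome_prob rho : density rho -> \sum_y outcome_prob H rho y = 1.
Proof.
case=> tr1 _; transitivity (expval (\sum_y P y) rho); last first.
  by rewrite sum_obs_proj /expval mul1mx tr1.
by rewrite /expval mulmx_suml Re_mxtrace_sum.
Qed.

Lemma outcome_prob_le1 rho y : density rho -> outcome_prob H rho y <= 1.
Proof.
move=> rhoP; rewrite -(sum_outcome_prob rhoP) (bigD1 y) //= lerDl.
by rewrite sumr_ge0 // => z _; exact: outcome_prob_ge0.
Qed.

Lemma expval_obs rho : expval (obs_mx H) rho = \sum_y outcome_prob H rho y * h y.
Proof.
rewrite /expval /outcome_prob obs_decomp mulmx_suml Re_mxtrace_sum.
by apply: eq_bigr => y _; rewrite -scalemxAl mxtraceZ Re_realM mulrC.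
Qed.

Lemma obs_mx2 : obs_mx H *m obs_mx H = \sum_y (h y ^+ 2)%:C *: P y.
Proof.
rewrite {2}obs_decomp mulmx_sumr; apply: eq_bigr => y _.
by rewrite -scalemxAr mulmx_obs_proj scalerA -rmorphM -expr2.
Qed.

Lemma expval_obs2 rho :
  expval (obs_mx H *m obs_mx H) rho = \sum_y outcome_prob H rho y * h y ^+ 2.
Proof.
rewrite /expval /outcome_prob obs_mx2 mulmx_suml Re_mxtrace_sum.
by apply: eq_bigr => y _; rewrite -scalemxAl mxtraceZ Re_realM mulrC.
Qed.

Lemma adj_mul_ge0 m (v : 'cV[R[i]]_m) : 0 <= (v^t* *m v) 0 0.
Proof. by rewrite mxE sumr_ge0 // => i _; rewrite !mxE mulrC mul_conjC_ge0. Qed.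

Lemma norm2_eq1 m (v : 'cV[R[i]]_m) : norm2 v = 1 -> (v^t* *m v) 0 0 = 1.
Proof.
move=> /(congr1 (fun x => x ^+ 2)); rewrite sqr_sqrtr ?Re_ge0 ?adj_mul_ge0 //.
rewrite expr1n => v1; rewrite -[LHS]RRe_real ?v1 //.
exact/ger0_real/adj_mul_ge0.
Qed.

(** [eigenvalue] provides a row eigenvector; since the observable is Hermitian and [h y] real, its
    adjoint is a column eigenvector, which is then normalized. *)
Lemma exists_unit_eigenvector y : exists2 v : 'cV[R[i]]_(2 ^ n),
  norm2 v = 1 & P y *m v = v.
Proof.
have /eigenvalueP[v vH v0] : eigenvalue (obs_mx H) (h y)%:C.
  by apply/obs_val_eigen; exists y.
pose w := v^t*; pose a := norm2 w.
have Pw : P y *m w = w.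
  by apply/obs_proj_range; rewrite /w -[in LHS]obs_mxC -adjmxM vH adjmxZ conj_real.
have w0 : 0 < (w^t* *m w) 0 0.
  rewrite lt_def adj_mul_ge0 andbT; apply: contra v0.
  rewrite /w trmxCK mxE psumr_eq0; last first.
    by move=> i _; rewrite !mxE mul_conjC_ge0.
  move=> /allP wi0; apply/eqP/rowP => i; apply/eqP.
  have := wi0 i (mem_index_enum _); rewrite !mxE /=.
  by rewrite -normCK expf_eq0 normr_eq0.
have a2 : (a ^+ 2)%:C = (w^t* *m w) 0 0.
  rewrite /a sqr_sqrtr ?Re_ge0 ?(ltW w0) // RRe_real //.
  exact/ger0_real/ltW.
have a0 : a != 0.
  by apply: contraTneq w0 => a0; rewrite -a2 a0 expr0n ltxx.
exists (a^-1%:C *: w); last by rewrite -scalemxAr Pw.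
rewrite /norm2 adjmxZ conj_real -scalemxAl -scalemxAr scalerA mxE -a2.
rewrite -!rmorphM /= -expr2 -exprMn mulVf // expr1n sqrtr1 //.
Qed.

(** Removing the rank-one projection onto a unit vector of the range leaves a projection [Q], whose
    trace is nonnegative because [Q = Q Q^*]. *)
Lemma mxtrace_obs_proj_ge1 y : 1 <= complex.Re (\tr (P y)).
Proof.
have [v /norm2_eq1 v1 Pv] := exists_unit_eigenvector y.
have vv : v^t* *m v = 1%:M by rewrite [LHS]mx11_scalar v1.
have vP : v^t* *m P y = v^t* by rewrite -[in LHS](obs_projC y) -adjmxM Pv.
pose Q := P y - v *m v^t*.
have QC : Q^t* = Q by rewrite /Q adjmxB obs_projC adjmxM trmxCK.
have QQ : Q *m Q = Q.
  rewrite /Q mulmxBl !mulmxBr obs_proj_idem mulmxA Pv -mulmxA vP.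
  by rewrite -mulmxA [v^t* *m (v *m _)]mulmxA vv mul1mx subrr subr0.
have : 0 <= \tr Q by rewrite -QQ -{2}QC mxtrace_gram_ge0.
rewrite raddfB /= [X in _ - X]mxtrace_mulC trace_mx11 v1 subr_ge0.
by rewrite lecE => /andP[].
Qed.

Lemma obs_tr2_ge : \sum_y h y ^+ 2 <= obs_tr2 H.
Proof.
rewrite /obs_tr2 obs_mx2 Re_mxtrace_sum; apply: ler_sum => y _.
by rewrite mxtraceZ Re_realM ler_peMr ?sqr_ge0 ?mxtrace_obs_proj_ge1.
Qed.

Lemma obs_val_le_opnorm y : `|h y| <= opnorm (obs_mx H).
Proof.
(* For a unit vector, [|H v|^2] is the second moment of the measured eigenvalue in the pure state
   [v v^*]. *)
have norm2H v : norm2 v = 1 -> norm2 (obs_mx H *m v) ^+ 2 =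
    \sum_z outcome_prob H (v *m v^t*) z * h z ^+ 2.
  move=> v1; rewrite sqr_sqrtr ?Re_ge0 ?adj_mul_ge0 // -expval_obs2 /expval.
  rewrite adjmxM obs_mxC -[in RHS]mulmxA mulmxA [in RHS]mulmxA mxtrace_mulC.
  by rewrite trace_mx11 !mulmxA.
have [v v1 Pv] := exists_unit_eigenvector y.
have Hv : norm2 (obs_mx H *m v) = `|h y|.
  have /obs_proj_range -> := Pv.
  rewrite /norm2 adjmxZ conj_real -scalemxAl -scalemxAr scalerA mxE.
  by rewrite norm2_eq1 // mulr1 -rmorphM -expr2 sqrtr_sqr.
rewrite -Hv; apply: ub_le_sup; last by exists v.
(* The supremum is only an upper bound if the set is bounded; bounding each outcome probability by 1
   gives this crude bound. *)
exists (Num.sqrt (\sum_z h z ^+ 2)) => _ [w w1 <-].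
rewrite -[leLHS]ger0_norm ?sqrtr_ge0 // -sqrtr_sqr ler_wsqrtr // norm2H //.
have /density_pure wP := norm2_eq1 w1.
apply: ler_sum => z _.
by rewrite ler_piMl ?sqr_ge0 ?outcome_prob_le1.
Qed.

Lemma expval_le_opnorm rho :
  density rho -> `|expval (obs_mx H) rho| <= opnorm (obs_mx H).
Proof.
move=> rhoP; rewrite expval_obs (le_trans (ler_norm_sum _ _ _)) //.
rewrite -[leRHS]mul1r -(sum_outcome_prob rhoP) mulr_suml ler_sum // => y _.
rewrite normrM ger0_norm ?outcome_prob_ge0 // ler_wpM2l ?outcome_prob_ge0 //.
exact: obs_val_le_opnorm.
Qed.

End Observable.

(** * Pauli noise and gates *)

Section Noise.
Context {R : realType} {n : nat} (ns : pauli_noise R n) (eps : R).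

(** The noise becomes a single mixture over all Pauli strings, the identity carrying the no-error
    weight and strings outside the support weight 0. *)
Definition noise_weight (s : pauli_index n) : R :=
  if s == pauli_id n then 1 - eps
  else if s \in noise_supp ns then eps * noise_prob ns s else 0.

Lemma sum_pauli_noise (V : zmodType) (F : pauli_index n -> V) :
    (forall s, s != pauli_id n -> s \notin noise_supp ns -> F s = 0) ->
  \sum_s F s = F (pauli_id n) + \sum_(s in noise_supp ns) F s.
Proof.
move=> F0; rewrite (bigID (mem (noise_supp ns))) /= addrC; congr (_ + _).
rewrite (bigD1 (pauli_id n)) ?noise_supp_nonid //= big1 ?addr0 // => s /andP[sn s1].
exact: F0.
Qed.

Lemma noise_weight_supp s :
  s \in noise_supp ns -> noise_weight s = eps * noise_prob ns s.
Proof.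
move=> ss; rewrite /noise_weight ss; case: eqVneq => // s1.
by rewrite s1 (negbTE (noise_supp_nonid ns)) in ss.
Qed.

Lemma noise_channelE rho : noise_channel ns eps rho =
  \sum_s (noise_weight s)%:C *: dagger_conj (pauli s) rho.
Proof.
rewrite sum_pauli_noise; last first.
  by move=> s s1 sn; rewrite /noise_weight (negbTE s1) (negbTE sn) scale0r.
rewrite /noise_channel {1}/noise_weight eqxx pauli_id1 dagger_conj1; congr (_ + _).
rewrite scaler_sumr; apply: eq_bigr => s ss.
rewrite /noise_op dagger_conjZ sqr_sqrtr ?noise_prob_ge0 //.
by rewrite noise_weight_supp // scalerA rmorphM.
Qed.

Lemma sum_noise_weight : \sum_s noise_weight s = 1.
Proof.
rewrite sum_pauli_noise; last first.
  by move=> s s1 sn; rewrite /noise_weight (negbTE s1) (negbTE sn).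
rewrite {1}/noise_weight eqxx (eq_bigr (fun s => eps * noise_prob ns s)).
  by rewrite -mulr_sumr noise_prob_sum1 mulr1 subrK.
by move=> s ss; rewrite noise_weight_supp.
Qed.

Lemma noise_weight_ge0 s : 0 <= eps <= 1 -> 0 <= noise_weight s.
Proof.
case/andP=> e0 e1; rewrite /noise_weight; case: ifP => _; first by rewrite subr_ge0.
by case: ifP => // ss; rewrite mulr_ge0 ?noise_prob_ge0.
Qed.

Lemma noise_channel_is_linear : linear (noise_channel ns eps).
Proof.
move=> a rho sigma; rewrite !noise_channelE scaler_sumr -big_split /=.
apply: eq_bigr => s _; rewrite linearP scalerDr !scalerA.
by rewrite [a * _]mulrC.
Qed.

HB.instance Definition _ := GRing.isLinear.Build R[i] 'M[R[i]]_(2 ^ n)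
  'M[R[i]]_(2 ^ n) _ (noise_channel ns eps) noise_channel_is_linear.

Lemma density_noise_channel rho :
  0 <= eps <= 1 -> density rho -> density (noise_channel ns eps rho).
Proof.
move=> eps01 rhoP; rewrite noise_channelE; apply: density_convex.
- by move=> s; exact: noise_weight_ge0.
- exact: sum_noise_weight.
- by move=> s; apply: density_dagger_conj => //; exact: pauli_unitary.
Qed.

Lemma mxtrace_noise_channel rho : \tr (noise_channel ns eps rho) = \tr rho.
Proof.
rewrite noise_channelE (raddf_sum (@mxtrace R[i] _)) /=.
under eq_bigr => s _.
  rewrite mxtraceZ mxtrace_dagger_conj ?pauli_unitary //; over.
by rewrite -mulr_suml -rmorph_sum sum_noise_weight mul1r.
Qed.

(** The noise applied after the string [r] is a mixture of conjugations by [pauli s *m pauli r]. By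
    orthogonality only [s = r] has a nonzero trace, and it contributes [(2 ^ n) ^ 2 = 4 ^ n]. *)
Lemma supertrace_noise_pauli r :
  \sum_i \sum_j noise_channel ns eps (dagger_conj (pauli r) (delta_mx i j)) i j =
    (4 ^+ n * noise_weight r)%:C.
Proof.
transitivity (\sum_s (noise_weight s)%:C *
    (\tr (pauli s *m pauli r) * Num.conj (\tr (pauli s *m pauli r)))).
  under [RHS]eq_bigr => s _ do rewrite -supertrace_dagger_conj mulr_sumr.
  rewrite [RHS]exchange_big /=; apply: eq_bigr => i _.
  under [RHS]eq_bigr => s _ do rewrite mulr_sumr.
  rewrite [RHS]exchange_big /=; apply: eq_bigr => j _.
  rewrite noise_channelE summxE; apply: eq_bigr => s _.
  by rewrite mxE dagger_conjM.
rewrite (bigD1 r) //= big1 => [|s sr]; last first.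
  by rewrite pauli_tr (negbTE sr) mulr0n mul0r mulr0.
rewrite addr0 pauli_tr eqxx mulr1n conj_real -!rmorphM /=; congr (_%:C).
by rewrite mulrC -exprD addnn -mul2n exprM; congr (_ ^+ _ * _); rewrite -natrX.
Qed.

End Noise.

(** * The matrix exponential of an involution *)

Lemma ReD (R : realType) (x y : R[i]) :
  complex.Re (x + y) = complex.Re x + complex.Re y.
Proof. by case: x y => [a b] [c d]. Qed.

Lemma ImD (R : realType) (x y : R[i]) :
  complex.Im (x + y) = complex.Im x + complex.Im y.
Proof. by case: x y => [a b] [c d]. Qed.

Lemma Im_realM (R : realType) (a : R) (z : R[i]) :
  complex.Im (a%:C * z) = a * complex.Im z.
Proof. by case: z => b c /=; rewrite mul0r addr0. Qed.

Section Expmx.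
Context {R : realType}.

Lemma cvg_affine_lim (u v : R^nat) (a b x y : R) :
  u @ \oo --> x -> v @ \oo --> y ->
  limn (fun k => u k * a + v k * b) = x * a + y * b.
Proof.
move=> ux vy; apply: cvg_lim => //.
by apply: cvgD; apply: cvgMl.
Qed.

(* Even powers of [G] are 1 and odd ones are [G], so the exponential series
   splits into the cosine and the sine series. *)
Lemma expmx_involution m (G : 'M[R[i]]_m) (t : R) : G *m G = 1%:M ->
  expmx ((- 'i * t%:C) *: G) =
    (cos t)%:C *: 1%:M + (sin t)%:C *: (- 'i *: G).
Proof.
move=> GG.
have powG j : ((- 'i * t%:C) *: G) ^+ j =
    (- 'i * t%:C) ^+ j *: (if odd j then G else 1%:M).
  elim: j => [|j IH]; first by rewrite !expr0 scale1r.
  rewrite exprS IH [LHS](_ : _ = ((- 'i * t%:C) *: G) *m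
    ((- 'i * t%:C) ^+ j *: (if odd j then G else 1%:M))) //.
  rewrite -scalemxAl -scalemxAr scalerA -exprS; congr (_ *: _) => /=.
  by case: (odd j) => /=; rewrite ?GG ?mulmx1.
(* The sign is the one in the cosine and sine coefficients; the remaining factor [- 'i] appears
   exactly in odd degrees. *)
have powi j : (- 'i : R[i]) ^+ j =
    ((-1) ^+ j./2)%:C * (if odd j then - 'i else 1).
  have i2 : (- 'i : R[i]) ^+ 2 = (-1)%:C.
    by rewrite sqrrN; apply/eqP; rewrite eq_complex /= !mulr0 !mul0r !mulr1
      sub0r addr0 !eqxx.
  rewrite -{1}(odd_double_half j) exprD mulrC -mul2n exprM i2 rmorphXn.
  by case: (odd j); rewrite /= ?expr1 ?expr0.
have partial k : \sum_(j < k) (j`!%:R)^-1 *: ((- 'i * t%:C) *: G) ^+ j =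
    (series (cos_coeff t) k)%:C *: 1%:M
    + (series (sin_coeff t) k)%:C *: (- 'i *: G).
  rewrite /series /= !big_mkord !rmorph_sum !scaler_suml -big_split /=.
  apply: eq_bigr => j _; rewrite powG exprMn powi /cos_coeff /sin_coeff /=.
  rewrite -!rmorphXn /= scalerA.
  rewrite -(rmorph_nat (real_complex R)) -fmorphV /=.
  case: (boolP (odd j)) => jo /=; rewrite ?mul0r ?scale0r ?add0r ?addr0.
    rewrite scalerA; congr (_ *: _); rewrite mul1r.
    (* The sine coefficient halves [j.-1], whereas [powi] halves [j]; the two agree for odd [j]. *)
    have -> : (j.-1)./2 = j./2.
      by case: (val j) jo => // l /= /negbTE lo; rewrite uphalf_half lo.
    by rewrite !rmorphM /=; ring.
  by congr (_ *: _); rewrite mul1r !rmorphM /=; ring.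
have cvgc : series (cos_coeff t) @ \oo --> cos t.
  by rewrite unlock; exact: is_cvg_series_cos_coeff.
have cvgs : series (sin_coeff t) @ \oo --> sin t.
  by rewrite unlock; exact: is_cvg_series_sin_coeff.
apply/matrixP => a b; rewrite /expmx mxE.
rewrite (_ : (fun k => complex.Re _) = (fun k =>
    series (cos_coeff t) k * complex.Re ((1%:M : 'M[R[i]]_m) a b)
    + series (sin_coeff t) k * complex.Re ((- 'i *: G) a b))); last first.
  apply/funext => k; rewrite partial mxE [X in X + _]mxE [X in _ + X]mxE.
  by rewrite ReD !Re_realM.
rewrite (_ : (fun k => complex.Im _) = (fun k =>
    series (cos_coeff t) k * complex.Im ((1%:M : 'M[R[i]]_m) a b)
    + series (sin_coeff t) k * complex.Im ((- 'i *: G) a b))); last first.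
  apply/funext => k; rewrite partial mxE [X in X + _]mxE [X in _ + X]mxE.
  by rewrite ImD !Im_realM.
rewrite !(cvg_affine_lim _ _ cvgc cvgs) [RHS]mxE.
rewrite [X in _ = X + _]mxE [X in _ = _ + X]mxE.
by apply/eqP; rewrite eq_complex ReD ImD !Re_realM !Im_realM !eqxx.
Qed.

End Expmx.

(** A product of matrices is linear in each factor. By [uniq r] the index [d] occurs once, so the
    decomposition of its factor passes through the whole product. *)
Lemma foldl_mulmx_affine (R : realType) m (T : eqType)
    (A B E : T -> 'M[R[i]]_m) (a b : R[i]) (d : T) (v : 'cV[R[i]]_m) (r : seq T) :
    uniq r -> d \in r -> A d = a *: B d + b *: E d ->
    (forall d', d' != d -> A d' = B d' /\ A d' = E d') ->
  foldl (fun w d => A d *m w) v r =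
    a *: foldl (fun w d => B d *m w) v r + b *: foldl (fun w d => E d *m w) v r.
Proof.
move=> + + Ad Ad'; elim/last_ind: r => // r d' IH.
rewrite rcons_uniq mem_rcons inE => /andP[dr ur] /predU1P[dd'|ddr].
  rewrite !foldl_rcons -dd' Ad mulmxDl -!scalemxAl; rewrite -dd' in dr.
  have eqr (F G : T -> 'M[R[i]]_m) : {in r, F =1 G} ->
      foldl (fun w d => F d *m w) v r = foldl (fun w d => G d *m w) v r.
    elim: (r) (v) => //= x r' IHr w FG; rewrite FG ?mem_head // IHr //.
    by move=> y yr; rewrite FG // inE yr orbT.
  rewrite -(eqr A B) ?(eqr A E) // => x xr;
    by have /Ad'[] : x != d by apply: contraNneq dr => <-.
have /Ad'[AB AE] : d' != d by apply: contraNneq dr => ->.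
by rewrite !foldl_rcons IH // mulmxDr -!scalemxAr {1}AB AE.
Qed.

(** * Parameterized gates and the parameter-shift rule *)

Section Sesq.
Context {R : realType} {m : nat} (K : 'M[R[i]]_m).
Implicit Types x y z : 'cV[R[i]]_m.

Definition sesq x y : R := complex.Re ((x^t* *m K *m y) 0 0).

Lemma sesqDl x y z : sesq (x + y) z = sesq x z + sesq y z.
Proof. by rewrite /sesq adjmxD !mulmxDl [X in complex.Re X]mxE ReD. Qed.

Lemma sesqDr x y z : sesq x (y + z) = sesq x y + sesq x z.
Proof. by rewrite /sesq mulmxDr [X in complex.Re X]mxE ReD. Qed.

Lemma sesqZl (a : R) x y : sesq (a%:C *: x) y = a * sesq x y.
Proof.
by rewrite /sesq adjmxZ conj_real -2!scalemxAl [X in complex.Re X]mxE Re_realM.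
Qed.

Lemma sesqZr (a : R) x y : sesq x (a%:C *: y) = a * sesq x y.
Proof. by rewrite /sesq -scalemxAr [X in complex.Re X]mxE Re_realM. Qed.

End Sesq.

Section Gates.
Context {R : realType} {n D : nat} (C : circuit R n D).
Implicit Types (d : 'I_D) (t : R) (theta : 'rV[R]_D).

Lemma gateE d t : gate C d t =
  ((cos (t / 2))%:C *: 1%:M + (sin (t / 2))%:C *: (- 'i *: pauli (generator C d)))
    *m fixed_gate C d.
Proof.
by have := expmx_involution (t / 2) (pauli_sqr (generator C d)); rewrite /gate => ->.
Qed.

(** With [G ^ 2 = 1], the product [(c - i s G) (c + i s G)] reduces to [c ^ 2 + s ^ 2 = 1]. *)
Lemma gate_unitary d t : gate C d t \is unitarymx.
Proof.
rewrite gateE; apply: mul_unitarymx; last exact: fixed_gate_unitary.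
apply/unitarymxP; rewrite adjmxD !adjmxZ !conj_real adjmx1 pauli_adj.
rewrite (_ : Num.conj (- 'i : R[i]) = Num.imaginary); last first.
  by rewrite rmorphN /= conjCi opprK.
rewrite mulmxDl !mulmxDr -!scalemxAl -!scalemxAr mul1mx mulmx1 mul1mx pauli_sqr.
have ii : - 'i * 'i = 1 :> R[i] by rewrite mulNr -expr2 sqrCi opprK.
set G := pauli _; set c := _%:C; set s := _%:C.
rewrite !scalerA.
have -> : s * - 'i * (s * 'i) = s * s :> R[i].
  by rewrite -[RHS]mulr1 -ii; ring.
have -> : s * - 'i * c = - (c * (s * 'i)) by ring.
rewrite scaleNr addrA addrK -scalerDl -!expr2 -!rmorphXn -rmorphD /= cos2Dsin2.
by rewrite scale1r.
Qed.

(** Adding [pi] to the angle adds a quarter turn to the half-angle, so the gates at [a] and [a + pi]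
    span all gates along this parameter by the addition formulas. *)
Lemma gate_shift d a t : gate C d (a + t) =
  (cos (t / 2))%:C *: gate C d a + (sin (t / 2))%:C *: gate C d (a + pi).
Proof.
rewrite !gateE [(a + t) / 2]mulrDl [(a + pi) / 2]mulrDl cosDpihalf sinDpihalf.
move: (fixed_gate C d) (_ *: pauli _) => V G; rewrite cosD sinD.
rewrite [in RHS]scalemxAl [X in _ = _ + X]scalemxAl -mulmxDl; congr (_ *m _).
rewrite !scalerDr !scalerA -!rmorphM addrACA -!scalerDl -!rmorphD /=.
by congr (_ *: _ + _ *: _); apply: congr1; ring.
Qed.

Lemma psi_shift theta d t : psi C (theta + t *: delta_mx 0 d) =
  (cos (t / 2))%:C *: psi C theta
  + (sin (t / 2))%:C *: psi C (theta + pi *: delta_mx 0 d).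
Proof.
apply: (@foldl_mulmx_affine R (2 ^ n) 'I_D
  (fun d' => gate C d' ((theta + t *: delta_mx 0 d) 0 d'))
  (fun d' => gate C d' (theta 0 d'))
  (fun d' => gate C d' ((theta + pi *: delta_mx 0 d) 0 d')) _ _ d).
- exact: enum_uniq.
- exact: mem_enum.
- by rewrite !mxE !eqxx !mulr1 gate_shift.
- by move=> d' d'd; rewrite !mxE (negbTE d'd) !mulr0 !addr0.
Qed.

Lemma foldl_gate_channel theta :
  foldl (fun rho d => gate_channel C d (theta 0 d) rho)
      (rho0 : 'M[R[i]]_(2 ^ n)) (enum 'I_D) =
    psi C theta *m (psi C theta)^t*.
Proof.
rewrite /psi /rho0; elim: (enum _) ket0 => //= d r IH v; rewrite -IH.
by congr (foldl _ _ _); rewrite [in RHS]adjmxM /gate_channel /dagger_conj !mulmxA.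
Qed.

Lemma loss_expval Nh (H : observable R n Nh) theta :
  loss C H theta = expval (obs_mx H) (psi C theta *m (psi C theta)^t*).
Proof. by rewrite /loss /expval mulmxA mxtrace_mulC trace_mx11 mulmxA. Qed.

Lemma derive_along (f : 'rV[R]_D -> R) (x v : 'rV[R]_D) :
  'D_v f x = 'D_1 (fun t : R => f (x + t *: v)) 0.
Proof.
rewrite /derive /=.
suff -> : (fun h : R => h^-1 *: (f (h *: v + x) - f x)) =
    (fun h : R => h^-1 *: (f (x + (h *: 1 + 0) *: v) - f (x + 0 *: v))) by [].
by apply/funext => h; rewrite scale0r !addr0 [h *: 1]mulr1 [x + _]addrC.
Qed.

Lemma parameter_shift Nh (H : observable R n Nh) theta d :
  gradient (loss C H) theta 0 d =
  2^-1 * (loss C H (Defs.shift theta d true) - loss C H (Defs.shift theta d false)).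
Proof.
pose u := psi C theta; pose w := psi C (theta + pi *: delta_mx 0 d).
pose B := sesq (obs_mx H).
(* Along one coordinate the state is a real combination of [u] and [w], so the loss is a quadratic
   form in [cos (t / 2)] and [sin (t / 2)]; [z] collects the two cross terms. *)
have [x [y [z lossE]]] : exists x y z : R, forall t,
    loss C H (theta + t *: delta_mx 0 d) =
      cos (t / 2) ^+ 2 * x + sin (t / 2) ^+ 2 * y + cos (t / 2) * sin (t / 2) * z.
  exists (B u u), (B w w), (B u w + B w u) => t.
  rewrite (_ : loss _ _ _ = B (psi C (theta + t *: delta_mx 0 d))
    (psi C (theta + t *: delta_mx 0 d))) //.
  rewrite psi_shift -/u -/w /B.
  move: (cos _) (sin _) u w => c s x y.
  rewrite sesqDl !sesqDr.
  rewrite !sesqZl !sesqZr.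
  move: (sesq _ x x) (sesq _ y y) (sesq _ x y) (sesq _ y x) => p q r o.
  ring.
clear B u w.
have halfD : is_derive (0 : R) 1 (fun t : R => t / 2) 2^-1.
  by apply: is_derive_eq; rewrite scaler0 scaler0 add0r [_ *: 1]mulr1.
rewrite mxE derive_along.
have -> : (fun t : R => loss C H (theta + t *: delta_mx 0 d)) = (fun t =>
    cos (t / 2) ^+ 2 * x + sin (t / 2) ^+ 2 * y + cos (t / 2) * sin (t / 2) * z).
  exact/funext.
rewrite /Defs.shift !lossE derive_val !mul0r cos0 sin0.
rewrite (mulNr (pi / 2)) cosN sinN; set m := pi / 2 / 2.
(* Here [m] is [pi / 4]. The squared terms cancel between the two shifts, leaving
   [2 * cos m * sin m * z = z]; half of it is the derivative [z / 2] at 0. *)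
have m2 : cos m * sin m = 2^-1.
  have := sinD m m; rewrite -splitr sin_pihalf => h.
  by move: h; rewrite [sin m * _]mulrC; lra.
move: (cos m) (sin m) m2 => c s m2.
rewrite [LHS](_ : _ = 2^-1 * z); last by rewrite /GRing.scale /=; lra.
by rewrite -{1}m2; field.
Qed.

End Gates.

(** * Product laws on finite sample spaces *)

Section Expectation.
Context {R : realType} {T : finType}.
Implicit Types (p f g : T -> R) (c : R).

Definition finvar p f : R := expect p (fun t => (f t - expect p f) ^+ 2).

Lemma expectD p f g : expect p (fun t => f t + g t) = expect p f + expect p g.
Proof. by rewrite -big_split /=; apply: eq_bigr => t _; rewrite mulrDr. Qed.

Lemma expectZ p c f : expect p (fun t => c * f t) = c * expect p f.
Proof. by rewrite mulr_sumr; apply: eq_bigr => t _; rewrite mulrCA. Qed.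

Lemma expect_sum p (I : finType) (F : I -> T -> R) :
  expect p (fun t => \sum_i F i t) = \sum_i expect p (F i).
Proof.
by rewrite exchange_big /=; apply: eq_bigr => t _; rewrite mulr_sumr.
Qed.

Lemma expect_cst p c : \sum_t p t = 1 -> expect p (fun=> c) = c.
Proof. by move=> p1; rewrite /expect -mulr_suml p1 mul1r. Qed.

Lemma eq_expect p f g : f =1 g -> expect p f = expect p g.
Proof. by move=> fg; apply: eq_bigr => t _; rewrite fg. Qed.

Lemma expect_ge0 p f : (forall t, 0 <= p t) -> (forall t, 0 <= f t) ->
  0 <= expect p f.
Proof. by move=> p0 f0; apply: sumr_ge0 => t _; rewrite mulr_ge0. Qed.

Lemma ler_expect p f g : (forall t, 0 <= p t) -> (forall t, f t <= g t) ->
  expect p f <= expect p g.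
Proof. by move=> p0 fg; apply: ler_sum => t _; rewrite ler_wpM2l. Qed.

Lemma finvar_ge0 p f : (forall t, 0 <= p t) -> 0 <= finvar p f.
Proof. by move=> p0; apply: expect_ge0 => // t; exact: sqr_ge0. Qed.

Lemma finvarE p f : \sum_t p t = 1 ->
  finvar p f = expect p (fun t => f t ^+ 2) - expect p f ^+ 2.
Proof.
move=> p1; rewrite /finvar; set m := expect p f.
transitivity (expect p (fun t => f t ^+ 2 + (- (2 * m) * f t + m ^+ 2))).
  by apply: eq_expect => t; ring.
by rewrite !expectD expectZ expect_cst // -/m; ring.
Qed.

Lemma finvar_le p f : \sum_t p t = 1 ->
  finvar p f <= expect p (fun t => f t ^+ 2).
Proof. by move=> p1; rewrite finvarE // gerBl sqr_ge0. Qed.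

Lemma finvarZ p c f : finvar p (fun t => c * f t) = c ^+ 2 * finvar p f.
Proof.
rewrite /finvar -expectZ; apply: eq_expect => t.
by rewrite expectZ -mulrBr exprMn.
Qed.

Lemma expect_centered p f : \sum_t p t = 1 ->
  expect p (fun t => f t - expect p f) = 0.
Proof. by move=> p1; rewrite expectD expect_cst ?subrr. Qed.

(** Cauchy-Schwarz against the constant vector, obtained by summing
    [a y * a z <= (a y ^+ 2 + a z ^+ 2) / 2] over all pairs. *)
Lemma sqr_sum_le n (a : 'I_n -> R) :
  (\sum_y a y) ^+ 2 <= n%:R * \sum_y a y ^+ 2.
Proof.
set S := \sum_y a y ^+ 2.
have -> : n%:R * S = \sum_y \sum_z 2^-1 * (a y ^+ 2 + a z ^+ 2).
  transitivity (\sum_y 2^-1 * (n%:R * a y ^+ 2 + S)); last first.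
    apply: eq_bigr => y _; rewrite -mulr_sumr; congr (_ * _).
    by rewrite big_split /= sumr_const card_ord mulr_natl.
  rewrite -mulr_sumr big_split /= -mulr_sumr -/S sumr_const card_ord -mulr_natl.
  by field.
rewrite expr2 big_distrlr /=; apply: ler_sum => y _; apply: ler_sum => z _.
have -> : a y * a z = 2^-1 * (a y ^+ 2 + a z ^+ 2) - 2^-1 * (a y - a z) ^+ 2.
  by field.
by rewrite gerBl mulr_ge0 ?sqr_ge0 // invr_ge0.
Qed.

End Expectation.

Section ProductLaw.
Context {R : realType} {I T : finType} (p : I -> T -> R).
Hypothesis p1 : forall i, \sum_t p i t = 1.

Definition product_law (o : {ffun I -> T}) : R := \prod_i p i (o i).

Lemma expect_prod (F : I -> T -> R) :
  expect product_law (fun o => \prod_i F i (o i)) = \prod_i expect (p i) (F i).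
Proof.
rewrite /expect bigA_distr_bigA /=; apply: eq_bigr => o _.
by rewrite -big_split.
Qed.

Lemma sum_product_law : \sum_o product_law o = 1.
Proof.
transitivity (expect product_law (fun o => \prod_(i : I) 1)).
  by apply: eq_bigr => o _; rewrite big1 ?mulr1.
by rewrite (expect_prod (fun _ _ => 1)) big1 // => i _; rewrite expect_cst.
Qed.

(** Marginals come from the product formula with the constant factor 1 at all other coordinates. *)
Lemma expect_coord i (f : T -> R) :
  expect product_law (fun o => f (o i)) = expect (p i) f.
Proof.
pose F j t := if j == i then f t else 1.
transitivity (expect product_law (fun o => \prod_j F j (o j))).
  apply: eq_expect => o; rewrite (bigD1 i) //= {1}/F eqxx big1 ?mulr1 // => j ji.
  by rewrite /F (negbTE ji).
rewrite expect_prod (bigD1 i) //= [X in _ * X]big1 ?mulr1 => [|j ji].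
  by apply: eq_expect => t; rewrite /F eqxx.
by rewrite /F (negbTE ji) expect_cst.
Qed.

Lemma expect_coord2 i j (f g : T -> R) : i != j ->
  expect product_law (fun o => f (o i) * g (o j)) = expect (p i) f * expect (p j) g.
Proof.
move=> ij; pose F k t := if k == i then f t else if k == j then g t else 1.
have ji : j != i by rewrite eq_sym.
transitivity (expect product_law (fun o => \prod_k F k (o k))).
  apply: eq_expect => o; rewrite (bigD1 i) //= (bigD1 j) //= big1
      => [|k /andP[ki kj]].
    by rewrite /F eqxx (negbTE ji) eqxx mulr1.
  by rewrite /F (negbTE ki) (negbTE kj).
rewrite expect_prod (bigD1 i) //= (bigD1 j) //= [X in _ * (_ * X)]big1
  => [|k /andP[ki kj]].
  by rewrite mulr1; congr (_ * _); apply: eq_expect => t;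
    rewrite /F ?eqxx ?(negbTE ji) ?eqxx.
by rewrite /F (negbTE ki) (negbTE kj) expect_cst.
Qed.

(** Bias-variance decomposition: after centering each summand, independence kills the linear and the
    cross terms. The constant [c] makes room for minus the target value. *)
Lemma expect_sqr_sum (f : I -> T -> R) (c : R) :
  expect product_law (fun o => (c + \sum_i f i (o i)) ^+ 2) =
    (c + \sum_i expect (p i) (f i)) ^+ 2 + \sum_i finvar (p i) (f i).
Proof.
set c' := c + \sum_i expect (p i) (f i).
pose g i t := f i t - expect (p i) (f i).
have Eg i : expect (p i) (g i) = 0 by exact: expect_centered.
transitivity (expect product_law (fun o =>
    c' ^+ 2 + (\sum_i (c' *+ 2) * g i (o i) + \sum_i \sum_j g i (o i) * g j (o j)))).
  apply: eq_expect => o.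
  have -> : c + \sum_i f i (o i) = c' + \sum_i g i (o i).
    by rewrite /g sumrB /c'; ring.
  by rewrite -mulr_sumr -big_distrlr /=; move: c' (\sum_i _) => x y; ring.
rewrite !expectD expect_cst ?sum_product_law //; congr (_ + _).
rewrite !expect_sum big1 ?add0r => [|i _]; last first.
  by rewrite (expect_coord i (fun t => _ * g i t)) expectZ Eg mulr0.
apply: eq_bigr => i _; rewrite expect_sum (bigD1 i) //= big1 ?addr0 => [|j ji].
  rewrite (expect_coord i (fun t => g i t * g i t)).
  by apply: eq_expect => t; rewrite -expr2.
by rewrite expect_coord2 ?Eg ?mul0r // eq_sym.
Qed.

End ProductLaw.

(** * Empirical means over shots and sampled circuits *)

Section Shots.
Context {R : realType} {J T : finType} {N : nat}.

Lemma expect_shots (p : J -> T -> R) (h : T -> R) (a : J -> R) :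
    (0 < N)%N -> (forall j, \sum_t p j t = 1) ->
  expect (fun o : {ffun J * 'I_N -> T} => \prod_i p i.1 (o i))
    (fun o => \sum_j a j * (N%:R^-1 * \sum_k h (o (j, k)))) =
  \sum_j a j * expect (p j) h.
Proof.
move=> N0 p1; have N0' : N%:R != 0 :> R by rewrite pnatr_eq0 -lt0n.
rewrite expect_sum; apply: eq_bigr => j _; rewrite !expectZ expect_sum.
under eq_bigr => k _ do
  rewrite (expect_coord (p := fun i => p i.1) (fun i => p1 i.1) (j, k) h) /=.
by rewrite sumr_const card_ord -[_ *+ N]mulr_natl; field.
Qed.

(** Every shot is a separate independent summand with weight [a j / N]; the [N] shots of a setting
    restore its mean and divide its variance by [N]. *)
Lemma expect_sqr_shots (p : J -> T -> R) (h : T -> R) (a : J -> R) (c : R) :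
    (0 < N)%N -> (forall j, \sum_t p j t = 1) ->
  expect (fun o : {ffun J * 'I_N -> T} => \prod_i p i.1 (o i))
    (fun o => (c + \sum_j a j * (N%:R^-1 * \sum_k h (o (j, k)))) ^+ 2) =
  (c + \sum_j a j * expect (p j) h) ^+ 2
  + N%:R^-1 * \sum_j a j ^+ 2 * finvar (p j) h.
Proof.
move=> N0 p1; have N0' : N%:R != 0 :> R by rewrite pnatr_eq0 -lt0n.
pose f (i : J * 'I_N) t := a i.1 / N%:R * h t.
have sumE (F : J -> R) : \sum_(i : J * 'I_N) F i.1 = N%:R * \sum_j F j.
  rewrite -(pair_bigA _ (fun j k => F j)) /= mulr_sumr.
  by apply: eq_bigr => j _; rewrite sumr_const card_ord mulr_natl.
transitivity (expect (product_law (fun i => p i.1))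
    (fun o => (c + \sum_i f i (o i)) ^+ 2)).
  apply: eq_expect => o; congr (_ ^+ 2); congr (_ + _).
  transitivity (\sum_j \sum_k f (j, k) (o (j, k))); last first.
    by rewrite pair_bigA; apply: eq_bigr => -[].
  by apply: eq_bigr => j _; rewrite mulrA mulr_sumr.
rewrite expect_sqr_sum //; congr ((_ + _) ^+ 2 + _).
  under eq_bigr do rewrite expectZ.
  rewrite (sumE (fun j => a j / N%:R * expect (p j) h)) mulr_sumr.
  by apply: eq_bigr => j _; field.
under eq_bigr do rewrite finvarZ.
rewrite (sumE (fun j => (a j / N%:R) ^+ 2 * finvar (p j) h)) !mulr_sumr.
by apply: eq_bigr => j _; field.
Qed.

End Shots.

Lemma expect_pair (R : realType) (A B : finType) (w : A -> R) (l : A -> B -> R)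
    (X : A * B -> R) :
  expect (fun o => w o.1 * l o.1 o.2) X =
    expect w (fun a => expect (l a) (fun b => X (a, b))).
Proof.
rewrite /expect (eq_bigr (fun a => \sum_b w a * (l a b * X (a, b)))).
  by rewrite pair_bigA; apply: eq_bigr => -[a b] _; rewrite mulrA.
by move=> a _; rewrite mulr_sumr.
Qed.

Section DifferenceWeight.
Context {R : realType} {D : nat} (d : 'I_D).

(** One gradient component is encoded as a weighted sum over all pairs of coordinate and sign, so
    that the formulas for weighted empirical means apply to the full outcome space. *)
Definition diff_weight (j : 'I_D * bool) : R :=
  if j.1 == d then (if j.2 then 2^-1 else - 2^-1) else 0.

Lemma sum_diff_weight (F : 'I_D * bool -> R) :
  \sum_j diff_weight j * F j = 2^-1 * (F (d, true) - F (d, false)).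
Proof.
transitivity (\sum_d' \sum_b diff_weight (d', b) * F (d', b)).
  by rewrite pair_bigA; apply: eq_bigr => -[].
rewrite (bigD1 d) //= [X in _ + X]big1 ?addr0 => [|d' d'd]; last first.
  by apply: big1 => b _; rewrite /diff_weight /= (negbTE d'd) mul0r.
by rewrite big_bool /diff_weight /= eqxx; ring.
Qed.

Lemma sum_sqr_diff_weight (F : 'I_D * bool -> R) :
  \sum_j diff_weight j ^+ 2 * F j = 4^-1 * (F (d, true) + F (d, false)).
Proof.
transitivity (\sum_d' \sum_b diff_weight (d', b) ^+ 2 * F (d', b)).
  by rewrite pair_bigA; apply: eq_bigr => -[].
rewrite (bigD1 d) //= [X in _ + X]big1 ?addr0 => [|d' d'd]; last first.
  by apply: big1 => b _; rewrite /diff_weight /= (negbTE d'd) expr0n mul0r.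
by rewrite big_bool /diff_weight /= eqxx; field.
Qed.

End DifferenceWeight.

Section Mitigation.
Context {R : realType} {S T : finType} {D Nc M : nat}.
Variables (W sg : S -> R) (P : S -> 'I_D -> bool -> T -> R) (h : T -> R) (Z : R).
Hypothesis Nc0 : (0 < Nc)%N.
Hypothesis M0 : (0 < M)%N.
Hypothesis W1 : \sum_s W s = 1.
Hypothesis P1 : forall s d b, \sum_t P s d b t = 1.

(** Conditional mean, given a sampled circuit [s], of the signed and [Z]-scaled half difference that
    the estimator averages over circuits. *)
Definition circuit_mean d s : R :=
  Z * sg s * (2^-1 * (expect (P s d true) h - expect (P s d false) h)).

(* Law of total variance: conditionally on the circuits only the shots
   fluctuate, and the conditional mean is an average of [Nc] independent copies
   of [circuit_mean]. *)
Lemma expect_sqr_mitigated d (g : R) :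
  expect (fun c : {ffun 'I_Nc -> S} => \prod_l W (c l)) (fun c =>
    expect (fun m : {ffun 'I_Nc * 'I_D * bool * 'I_M -> T} =>
        \prod_i P (c i.1.1.1) i.1.1.2 i.1.2 (m i))
      (fun m => (g + Z / Nc%:R * \sum_l sg (c l) *
        (2^-1 * (M%:R^-1 * (\sum_k h (m (l, d, true, k)))
               - M%:R^-1 * (\sum_k h (m (l, d, false, k)))))) ^+ 2)) =
  (g + expect W (circuit_mean d)) ^+ 2 + Nc%:R^-1 * finvar W (circuit_mean d)
  + (4 * (Nc * M)%:R)^-1 * expect W (fun s =>
      (Z * sg s) ^+ 2 * (finvar (P s d true) h + finvar (P s d false) h)).
Proof.
have Nc0' : Nc%:R != 0 :> R by rewrite pnatr_eq0 -lt0n.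
have M0' : M%:R != 0 :> R by rewrite pnatr_eq0 -lt0n.
(* Regroups a triple of circuit, coordinate and sign so that the sum over signs and coordinates can
   be collapsed by the difference weights. *)
have sum3 (u : 'I_Nc -> R) (v : 'I_D * bool -> R) (F : 'I_Nc * 'I_D * bool -> R) :
    \sum_j u j.1.1 * v (j.1.2, j.2) * F j =
    \sum_l u l * \sum_e v e * F (l, e.1, e.2).
  transitivity (\sum_(x : 'I_Nc * ('I_D * bool))
      u x.1 * v x.2 * F (x.1, x.2.1, x.2.2)).
    rewrite (reindex (fun x : 'I_Nc * ('I_D * bool) => (x.1, x.2.1, x.2.2))) /=.
      by apply: eq_bigr => -[l [d' b]].
    exists (fun j => (j.1.1, (j.1.2, j.2))) => [[l [d' b]]|[[l d'] b]] //.
  transitivity (\sum_l \sum_e u l * v e * F (l, e.1, e.2)).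
    by rewrite pair_bigA.
  by apply: eq_bigr => l _; rewrite mulr_sumr; apply: eq_bigr => e _; rewrite mulrA.
pose V s := finvar (P s d true) h + finvar (P s d false) h.
pose a (c : {ffun 'I_Nc -> S}) l := Z / Nc%:R * sg (c l).
transitivity (expect (product_law (fun=> W)) (fun c : {ffun 'I_Nc -> S} =>
    (g + \sum_l Nc%:R^-1 * circuit_mean d (c l)) ^+ 2
    + M%:R^-1 * \sum_l a c l ^+ 2 * (4^-1 * V (c l)))).
  apply: eq_expect => c.
  transitivity (expect (fun m : {ffun 'I_Nc * 'I_D * bool * 'I_M -> T} =>
      \prod_i P (c i.1.1.1) i.1.1.2 i.1.2 (m i))
    (fun m => (g + \sum_j (a c j.1.1 * diff_weight d (j.1.2, j.2)) *
      (M%:R^-1 * \sum_k h (m (j, k)))) ^+ 2)).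
    apply: eq_expect => m; congr ((g + _) ^+ 2).
    rewrite (sum3 (a c) (diff_weight d) (fun j => M%:R^-1 * \sum_k h (m (j, k)))).
    by rewrite mulr_sumr; apply: eq_bigr => l _; rewrite sum_diff_weight mulrA.
  rewrite (expect_sqr_shots (p := fun j => P (c j.1.1) j.1.2 j.2)) //.
  congr ((g + _) ^+ 2 + M%:R^-1 * _).
    rewrite (sum3 (a c) (diff_weight d) (fun j => expect (P (c j.1.1) j.1.2 j.2) h)).
    apply: eq_bigr => l _; rewrite sum_diff_weight /a /circuit_mean /=.
    by rewrite [RHS]mulrA; congr (_ * _); rewrite mulrAC mulrC.
  under eq_bigr => j _ do rewrite exprMn.
  rewrite (sum3 (fun l => a c l ^+ 2) (fun e => diff_weight d e ^+ 2)
    (fun j => finvar (P (c j.1.1) j.1.2 j.2) h)).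
  by apply: eq_bigr => l _; rewrite sum_sqr_diff_weight.
(* Now the circuits are averaged: the squared conditional mean is a sum of independent summands, and
   each shot term depends on one circuit only. *)
rewrite expectD (expect_sqr_sum (fun=> W1) (fun _ s => Nc%:R^-1 * circuit_mean d s)).
rewrite expectZ expectZ finvarZ !sumr_const card_ord expect_sum.
under eq_bigr => l _.
  rewrite (expect_coord (p := fun=> W) (fun=> W1) l
    (fun s => (Z / Nc%:R * sg s) ^+ 2 * (4^-1 * V s))); over.
rewrite sumr_const card_ord.
congr ((g + _) ^+ 2 + _ + _).
- by rewrite -[(_ * _) *+ _]mulr_natl; field.
- by rewrite -[(_ * _) *+ _]mulr_natl; field.
rewrite -[expect _ _ *+ _]mulr_natl -!expectZ; apply: eq_expect => s.
by rewrite /V natrM; field; rewrite Nc0' M0'.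
Qed.

End Mitigation.

(** The centered variable is the sum over [y] of [h y] times a centered indicator. Cauchy-Schwarz
    costs the factor [n], and the indicator of [y] has Bernoulli variance [nu (p y)]. *)
Lemma finvar_le_nu (R : realType) n (p h : 'I_n -> R) :
    (forall t, 0 <= p t) -> \sum_t p t = 1 ->
  finvar p h <= n%:R * \sum_y h y ^+ 2 * nu (p y).
Proof.
move=> p0 p1; pose g y t := h y * ((t == y)%:R - p y).
have hE t : h t - expect p h = \sum_y g y t.
  rewrite /g; under [RHS]eq_bigr => y _ do rewrite mulrBr.
  rewrite sumrB (bigD1 t) //= eqxx mulr1 big1 ?addr0 => [|y yt]; last first.
    by rewrite eq_sym (negbTE yt) mulr0.
  by congr (_ - _); apply: eq_bigr => y _; rewrite mulrC.
have Eg y : expect p (fun t => g y t ^+ 2) = h y ^+ 2 * nu (p y).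
  transitivity (expect p (fun t =>
      h y ^+ 2 * ((1 - 2 * p y) * (t == y)%:R + p y ^+ 2))).
    apply: eq_expect => t; rewrite /g exprMn; congr (_ * _).
    by case: (t == y) => /=; ring.
  rewrite !(expectZ, expectD) expect_cst // /expect (bigD1 y) //= eqxx mulr1.
  rewrite big1 ?addr0 => [|t ty]; last by rewrite (negbTE ty) mulr0.
  by rewrite /nu; congr (_ * _); ring.
under [X in _ <= _ * X]eq_bigr do rewrite -Eg.
rewrite -expect_sum -expectZ; apply: ler_expect => // t.
by rewrite hE sqr_sum_le.
Qed.

(** * Expansion of a composition of sums of linear maps *)

Lemma eq_foldl (T S : Type) (f g : S -> T -> S) z r :
  (forall x y, f x y = g x y) -> foldl f z r = foldl g z r.
Proof. by move=> fg; elim: r z => //= x r IH z; rewrite fg IH. Qed.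

Section Multilinear.
Context {K : comNzRingType} {V : lmodType K} {S : finType}.

Lemma foldl_linear (T : Type) (O : T -> {linear V -> V}) (I : finType)
    (a : I -> K) (u : I -> V) (r : seq T) :
  foldl (fun v d => O d v) (\sum_i a i *: u i) r =
    \sum_i a i *: foldl (fun v d => O d v) (u i) r.
Proof.
elim: r u => //= d r IH u; rewrite linear_sum /= -IH; congr (foldl _ _ _).
by apply: eq_bigr => i _; rewrite linearZ.
Qed.

Definition ffun_cons D (x : S * {ffun 'I_D -> S}) : {ffun 'I_D.+1 -> S} :=
  [ffun i => if unlift ord0 i is Some j then x.2 j else x.1].

Lemma ffun_cons_bij D : bijective (@ffun_cons D).
Proof.
exists (fun f : {ffun 'I_D.+1 -> S} =>
  (f ord0, [ffun j : 'I_D => f (lift ord0 j)])) => [[s f]|f].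
  rewrite /ffun_cons ffunE unlift_none; congr pair.
  by apply/ffunP => j; rewrite !ffunE liftK.
by apply/ffunP => i; rewrite ffunE; case: unliftP => [j|] ->; rewrite ?ffunE.
Qed.

(** Distributivity, by induction on [D]: the first choice is split off through [ffun_cons], and
    linearity carries its sum through the remaining maps. *)
Lemma foldl_sum D (O : 'I_D -> S -> {linear V -> V}) (q : 'I_D -> S -> K) v :
  foldl (fun v d => \sum_s q d s *: O d s v) v (enum 'I_D) =
    \sum_(f : {ffun 'I_D -> S})
      (\prod_d q d (f d)) *: foldl (fun v d => O d (f d) v) v (enum 'I_D).
Proof.
elim: D O q v => [|D IH] O q v.
  rewrite enum_ord0 /= -scaler_suml.
  have -> : \sum_(f : {ffun 'I_0 -> S}) \prod_d q d (f d) = 1 :> K.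
    under eq_bigr do rewrite big_ord0.
    by rewrite sumr_const card_ffun card_ord expn0.
  by rewrite scale1r.
have foldl_map' (T1 T2 : Type) (f : V -> T2 -> V) (g : T1 -> T2) z r :
  foldl f z (map g r) = foldl (fun v x => f v (g x)) z r by elim: r z => /=.
rewrite enum_ordSl /= foldl_map'.
rewrite (IH (fun d => O (lift ord0 d)) (fun d => q (lift ord0 d))).
rewrite (reindex _ (onW_bij _ (ffun_cons_bij D))) /=.
transitivity (\sum_s \sum_f (\prod_d q d (ffun_cons (s, f) d)) *:
   foldl (fun w (d : 'I_D) => O (lift ord0 d) (f d) w) (O ord0 s v) (enum 'I_D)).
  rewrite exchange_big /=; apply: eq_bigr => f _.
  rewrite (foldl_linear (fun d => O (lift ord0 d) (f d))) scaler_sumr.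
  apply: eq_bigr => s _; rewrite scalerA big_ord_recl mulrC ffunE unlift_none /=.
  by congr (_ * _ *: _); apply: eq_bigr => d _; rewrite ffunE liftK.
rewrite pair_bigA /=; apply: eq_bigr => -[s f] _; congr (_ *: _) => /=.
rewrite foldl_map' ffunE unlift_none /=; congr (foldl _ _ _).
by apply/funext => w; apply/funext => d; rewrite ffunE liftK.
Qed.

End Multilinear.

Lemma density_rho0 (R : realType) n : density (rho0 : 'M[R[i]]_(2 ^ n)).
Proof.
apply: density_pure; rewrite mxE.
have n0 : (0 < 2 ^ n)%N by rewrite expn_gt0.
rewrite (bigD1 (Ordinal n0)) //= big1 ?addr0 => [|j j0].
  by rewrite !mxE /= conjC1 mulr1.
have /negbTE j0' : val j != 0%N by apply: contra j0 => j0; apply/eqP/val_inj/eqP.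
by rewrite !mxE j0' conjC0 mul0r.
Qed.

(** * Quasi-probability samples *)

Section Samples.
Context {R : realType} {n D : nat} (ns : pauli_noise R n) (eps : R).
Variables (C : circuit R n D) (q : 'I_D -> pauli_index n -> R).
Hypothesis eps01 : 0 <= eps <= 1.
Hypothesis qP : quasi_prob_repr ns eps C q.
Implicit Types (theta : 'rV[R]_D) (s : @circuit_sample n D).

Lemma density_noisy_op d t (r : pauli_index n) rho :
  density rho -> density (noisy_op ns eps C d t r rho).
Proof.
move=> rhoP; apply: density_noise_channel => //.
apply: density_dagger_conj; first exact: pauli_unitary.
by apply: density_dagger_conj => //; exact: gate_unitary.
Qed.

Lemma density_sample_state s theta : density (sample_state ns eps C s theta).
Proof.
rewrite /sample_state; move: rho0 (density_rho0 R n).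
elim: (enum 'I_D) => [|d r IH] rho rhoP; first exact: rhoP.
exact: IH (density_noisy_op d (theta 0 d) (s d) rhoP).
Qed.

Lemma noisy_state_sample theta : noisy_state ns eps C theta =
  sample_state ns eps C [ffun=> pauli_id n] theta.
Proof.
apply: eq_foldl => rho d.
by rewrite ffunE /noisy_op pauli_id1 [dagger_conj 1%:M _]dagger_conj1.
Qed.

Lemma density_noisy_state theta : density (noisy_state ns eps C theta).
Proof. by rewrite noisy_state_sample; exact: density_sample_state. Qed.

(** The gate is removed by feeding [W^* sigma W] to the representation at angle 0: the
    quasi-probabilities invert the noise channel itself. *)
Lemma noise_pauli_inverse d sigma :
  sigma = \sum_r (q d r)%:C *: noise_channel ns eps (dagger_conj (pauli r) sigma).
Proof.
have uW := gate_unitary C d 0; move: (qP d 0); rewrite /noisy_op /gate_channel.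
move: (gate C d 0) uW => W uW /(_ (dagger_conj (W^t*) sigma)).
rewrite (_ : dagger_conj W (dagger_conj (W^t*) sigma) = sigma) //.
by rewrite dagger_conjM (unitarymxP uW) dagger_conj1.
Qed.

(** Trace of the inversion identity at a state; noise and Pauli conjugations preserve the trace. *)
Lemma sum_quasi_prob d : \sum_r q d r = 1.
Proof.
have [tr1 _] := density_rho0 R n; apply: (@complexI R).
rewrite rmorph1 -tr1 (noise_pauli_inverse d rho0) rmorph_sum /=.
rewrite (raddf_sum (@mxtrace R[i] _)); apply: eq_bigr => r _ /=.
rewrite mxtraceZ mxtrace_noise_channel mxtrace_dagger_conj ?pauli_unitary //.
by rewrite tr1 mulr1.
Qed.

(** Supertrace of the inversion identity: the identity map gives [4 ^ n], and the term of [r] gives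
    [4 ^ n] times [q d r] times its noise weight. *)
Lemma sum_quasi_prob_weight d : \sum_r q d r * noise_weight ns eps r = 1.
Proof.
have n0 : (4 ^+ n)%:C != 0 :> R[i].
  rewrite -(rmorph0 (real_complex R)) (inj_eq (@complexI R)).
  by rewrite expf_neq0 ?pnatr_eq0.
apply: (@complexI R); apply: (mulfI n0).
transitivity (\sum_i \sum_j (delta_mx i j : 'M[R[i]]_(2 ^ n)) i j); last first.
  under eq_bigr => i _ do under eq_bigr => j _ do rewrite mxE !eqxx.
  rewrite !sumr_const !card_ord -mulrnA -expnD addnn -mul2n expnM.
  by rewrite rmorph1 mulr1 natrX rmorphXn rmorph_nat.
transitivity (\sum_r (q d r)%:C * (\sum_i \sum_j noise_channel ns eps
    (dagger_conj (pauli r) (delta_mx i j)) i j)).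
  rewrite rmorph_sum mulr_sumr; apply: eq_bigr => r _.
  by rewrite supertrace_noise_pauli /= -!rmorphM /=; apply: congr1; ring.
under eq_bigr => r _ do rewrite mulr_sumr.
rewrite exchange_big /=; apply: eq_bigr => i _.
under eq_bigr => r _ do rewrite mulr_sumr.
rewrite exchange_big /=; apply: eq_bigr => j _.
rewrite [in RHS](noise_pauli_inverse d (delta_mx i j)) summxE.
by apply: eq_bigr => r _; rewrite [RHS]mxE.
Qed.

Lemma qZ1_ge1 d : 1 <= qZ1 q d.
Proof.
rewrite -(sum_quasi_prob d) (le_trans (ler_norm _)) //.
exact: ler_norm_sum.
Qed.

Lemma qZ1_gt0 d : 0 < qZ1 q d. Proof. exact: lt_le_trans ltr01 (qZ1_ge1 d). Qed.

Lemma qZ_ge1 : 1 <= qZ q.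
Proof.
by rewrite /qZ; elim/big_rec: _ => // d x _ x1; rewrite mulr_ege1 ?qZ1_ge1.
Qed.

Lemma sample_prob_ge0 s : 0 <= sample_prob q s.
Proof. by apply: prodr_ge0 => d _; rewrite divr_ge0 ?(ltW (qZ1_gt0 d)). Qed.

Lemma sum_sample_prob : \sum_s sample_prob q s = 1.
Proof.
apply: (@sum_product_law R 'I_D (pauli_index n)
  (fun d r => `|q d r| / qZ1 q d)) => d.
by rewrite -mulr_suml divff // gt_eqF ?qZ1_gt0.
Qed.

Lemma sample_prob_sgn s :
  sample_prob q s * (qZ q * sample_sgn q s) = \prod_d q d (s d).
Proof.
rewrite /sample_prob /qZ /sample_sgn -!big_split /=; apply: eq_bigr => d _.
rewrite mulrA divfK ?gt_eqF ?qZ1_gt0 // mulrC; exact/esym/numEsg.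
Qed.

(** The squared sign is 1 unless some quasi-probability vanishes, and then the sample has
    probability 0. *)
Lemma sample_prob_sgn2 s :
  sample_prob q s * sample_sgn q s ^+ 2 = sample_prob q s.
Proof.
rewrite /sample_prob /sample_sgn -prodrXl -big_split /=; apply: eq_bigr => d _.
by rewrite sqr_sg; case: eqVneq => [->|_]; rewrite ?mulr1 // normr0 !mul0r.
Qed.

(** Unbiasedness: the signed sampling weights are the products of quasi-probabilities, which are the
    coefficients in the expansion of the ideal circuit. *)
Lemma expect_sample_expval Nh (H : observable R n Nh) theta :
  expect (sample_prob q) (fun s =>
    qZ q * sample_sgn q s * expval (obs_mx H) (sample_state ns eps C s theta)) =
  loss C H theta.
Proof.
rewrite loss_expval -foldl_gate_channel.
pose O d r : {linear 'M[R[i]]_(2 ^ n) -> 'M[R[i]]_(2 ^ n)} :=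
  noise_channel ns eps \o
    (dagger_conj (pauli r) \o dagger_conj (gate C d (theta 0 d))).
transitivity (expval (obs_mx H) (foldl (fun rho d => \sum_r (q d r)%:C *: O d r rho)
    rho0 (enum 'I_D))); last first.
  congr (expval _ _); apply: eq_foldl => rho d.
  by rewrite (qP d).
rewrite foldl_sum.
rewrite /expect; under eq_bigr => s _ do rewrite mulrA sample_prob_sgn.
rewrite -expval_sum; congr (expval _ _); apply: eq_bigr => s _.
by rewrite rmorph_prod.
Qed.

End Samples.

(** * Exact variance formulas for the two gradient estimators *)

Lemma expect_half_diff (R : realType) (T : finType) (W u x y : T -> R) :
  expect W (fun s => u s * (2^-1 * (x s - y s))) =
    2^-1 * (expect W (fun s => u s * x s) - expect W (fun s => u s * y s)).
Proof.
rewrite /expect -sumrB mulr_sumr; apply: eq_bigr => s _.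
by move: (W s) (u s) (x s) (y s) => a b c d; ring.
Qed.

Section GradientVariance.
Context {R : realType} {n D Nh : nat} (ns : pauli_noise R n) (eps : R).
Variables (C : circuit R n D) (H : observable R n Nh) (theta : 'rV[R]_D).
Hypothesis eps01 : 0 <= eps <= 1.

Definition obs_var (rho : 'M[R[i]]_(2 ^ n)) : R :=
  finvar (outcome_prob H rho) (obs_val H).

Lemma obs_var_ge0 rho : density rho -> 0 <= obs_var rho.
Proof. by move=> rhoP; apply: finvar_ge0 => y; exact: outcome_prob_ge0. Qed.

Lemma expect_outcome rho :
  expect (outcome_prob H rho) (obs_val H) = expval (obs_mx H) rho.
Proof. by rewrite expval_obs. Qed.

(** Subtracting the mean cancels the bias term, so only shot variances remain; the 4 is the square
    of the halving in the shift rule. *)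
Lemma noisy_varE Nm : (0 < Nm)%N -> noisy_var ns eps C H theta Nm =
  (4 * Nm%:R)^-1 * \sum_d
    (obs_var (noisy_state ns eps C (Defs.shift theta d true))
     + obs_var (noisy_state ns eps C (Defs.shift theta d false))).
Proof.
move=> Nm0; have Nm0' : Nm%:R != 0 :> R by rewrite pnatr_eq0 -lt0n.
pose p (j : 'I_D * bool) :=
  outcome_prob H (noisy_state ns eps C (Defs.shift theta j.1 j.2)).
have p1 j : \sum_y p j y = 1.
  by apply: sum_outcome_prob; exact: density_noisy_state.
have gradE d (o : {ffun 'I_D * bool * 'I_Nm -> 'I_Nh}) : noisy_grad H o 0 d =
    \sum_j diff_weight d j * (Nm%:R^-1 * \sum_k obs_val H (o (j, k))).
  by rewrite sum_diff_weight mxE.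
have meanE d : noisy_grad_mean ns eps C H theta Nm 0 d =
    \sum_j diff_weight d j * expect (p j) (obs_val H).
  rewrite mxE -(@expect_shots R _ _ Nm) //.
  by apply: eq_expect => o; rewrite gradE.
rewrite /noisy_var /sqnorm expect_sum mulr_sumr; apply: eq_bigr => d _.
transitivity (expect
  (fun o : {ffun 'I_D * bool * 'I_Nm -> 'I_Nh} => \prod_i p i.1 (o i))
  (fun o => (- noisy_grad_mean ns eps C H theta Nm 0 d +
    \sum_j diff_weight d j * (Nm%:R^-1 * \sum_k obs_val H (o (j, k)))) ^+ 2)).
  apply: eq_expect => o; rewrite -gradE [_ 0 d]mxE [X in _ + X]mxE.
  by rewrite addrC.
rewrite expect_sqr_shots // meanE addNr expr0n add0r sum_sqr_diff_weight.
by rewrite mulrA invfM [_^-1 * _^-1]mulrC.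
Qed.

Variable q : 'I_D -> pauli_index n -> R.
Hypothesis qP : quasi_prob_repr ns eps C q.

Lemma expect_circuit_mean d :
  expect (sample_prob q) (circuit_mean (sample_sgn q)
    (fun s d b => outcome_prob H (sample_state ns eps C s (Defs.shift theta d b)))
    (obs_val H) (qZ q) d) = gradient (loss C H) theta 0 d.
Proof.
rewrite parameter_shift.
rewrite -(expect_sample_expval qP H (Defs.shift theta d true)).
rewrite -(expect_sample_expval qP H (Defs.shift theta d false)).
rewrite -expect_half_diff; apply: eq_expect => s; rewrite /circuit_mean.
congr (_ * (_ * (_ - _))).
exact: expect_outcome.
exact: expect_outcome.
Qed.

Lemma qem_varE Nc M : (0 < Nc)%N -> (0 < M)%N ->
  qem_var ns eps C H theta q Nc M =
  Nc%:R^-1 * \sum_d finvar (sample_prob q) (circuit_mean (sample_sgn q)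
    (fun s d b => outcome_prob H (sample_state ns eps C s (Defs.shift theta d b)))
    (obs_val H) (qZ q) d)
  + (4 * (Nc * M)%:R)^-1 * qZ q ^+ 2 * \sum_d expect (sample_prob q) (fun s =>
      obs_var (sample_state ns eps C s (Defs.shift theta d true))
      + obs_var (sample_state ns eps C s (Defs.shift theta d false))).
Proof.
move=> Nc0 M0; set W := sample_prob q; set Z := qZ q.
pose P s d b := outcome_prob H (sample_state ns eps C s (Defs.shift theta d b)).
have P1 s d b : \sum_y P s d b y = 1.
  by apply: sum_outcome_prob; exact: density_sample_state.
have W1 : \sum_s W s = 1 by exact: sum_sample_prob qP.
rewrite /qem_var /sqnorm expect_sum !mulr_sumr -big_split /=.
apply: eq_bigr => d _.
pose law (c : {ffun 'I_Nc -> @circuit_sample n D})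
  (m : {ffun 'I_Nc * 'I_D * bool * 'I_M -> 'I_Nh}) : R :=
  \prod_i P (c i.1.1.1) i.1.1.2 i.1.2 (m i).
rewrite [LHS](expect_pair
  (fun c : {ffun 'I_Nc -> @circuit_sample n D} => \prod_l W (c l)) law).
transitivity (expect (fun c : {ffun 'I_Nc -> @circuit_sample n D} => \prod_l W (c l))
  (fun c => expect (law c) (fun m =>
    (- gradient (loss C H) theta 0 d + Z / Nc%:R * \sum_l sample_sgn q (c l) *
        (2^-1 * (M%:R^-1 * (\sum_k obs_val H (m (l, d, true, k)))
               - M%:R^-1 * (\sum_k obs_val H (m (l, d, false, k)))))) ^+ 2))).
  apply: eq_expect => c; apply: eq_expect => m; congr (_ ^+ 2).
  rewrite mxE [X in _ + X]mxE [X in X + _]mxE addrC.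
  by [].
rewrite expect_sqr_mitigated // expect_circuit_mean addNr expr0n add0r.
congr (_ + _); rewrite -mulrA; congr (_ * _); rewrite -expectZ.
apply: eq_bigr => s _; rewrite -[in RHS](_ : W s * sample_sgn q s ^+ 2 = W s).
  by move: (W s) (sample_sgn q s) (_ + _) => x y z; ring.
exact: sample_prob_sgn2.
Qed.

End GradientVariance.

Lemma nu_ge0 (R : realType) (x : R) : 0 <= x -> x <= 1 -> 0 <= nu x.
Proof. by move=> x0 x1; rewrite mulr_ge0 ?subr_ge0. Qed.

Lemma nu_le1 (R : realType) (x : R) : 0 <= x -> x <= 1 -> nu x <= 1.
Proof. by move=> x0 x1; rewrite mulr_ile1 ?subr_ge0 // gerBl. Qed.

(** The variance is at most the second moment; the squared sign is absorbed by [W], and half the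
    difference of two numbers in [[-o, o]] stays in that interval. *)
Lemma finvar_circuit_mean_le (R : realType) (S T : finType) D (W sg : S -> R)
    (P : S -> 'I_D -> bool -> T -> R) (h : T -> R) (z o : R) d :
    (forall s, 0 <= W s) -> \sum_s W s = 1 ->
    (forall s, W s * sg s ^+ 2 = W s) ->
    (forall s b, `|expect (P s d b) h| <= o) ->
  finvar W (circuit_mean sg P h z d) <= z ^+ 2 * o ^+ 2.
Proof.
move=> W0 W1 Wsg Eo; apply: (le_trans (finvar_le _ W1)).
rewrite -[leRHS](expect_cst _ W1).
apply: ler_sum => s _; rewrite /circuit_mean.
move: (Eo s true) (Eo s false) (Wsg s) (W0 s).
move: (expect _ _) (expect _ _) (sg s) (W s) => x y g w xo yo wg w0.
rewrite (_ : w * _ = (w * g ^+ 2) * (z ^+ 2 * (2^-1 * (x - y)) ^+ 2)); last by ring.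
rewrite wg ler_wpM2l // ler_wpM2l ?sqr_ge0 //.
have o0 : 0 <= o by apply: le_trans xo.
rewrite -[leLHS]real_normK ?num_real // lerXn2r ?nnegrE //.
by move: xo yo; rewrite !ler_norml => /andP[? ?] /andP[? ?]; apply/andP; split; lra.
Qed.

(** * Comparison of the variances *)

Section Bounds.
Context {R : realType} {n D Nh : nat} (ns : pauli_noise R n) (eps : R).
Variables (C : circuit R n D) (H : observable R n Nh).
Variable q : 'I_D -> pauli_index n -> R.
Hypothesis eps01 : 0 <= eps <= 1.
Hypothesis qP : quasi_prob_repr ns eps C q.
Local Notation W := (sample_prob q).
Local Notation state s th := (sample_state ns eps C s th).

Definition mean_nu (th : 'rV[R]_D) (y : 'I_Nh) : R :=
  expect W (fun s => nu (outcome_prob H (state s th) y)).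

Definition sup_mean_nu : R :=
  sup [set mean_nu thy.1 thy.2 | thy in [set: 'rV[R]_D * 'I_Nh]].

Lemma nu_outcome_ge0 rho y : density rho -> 0 <= nu (outcome_prob H rho y).
Proof.
by move=> rhoP; rewrite nu_ge0 ?outcome_prob_ge0 ?outcome_prob_le1.
Qed.

Lemma nu_outcome_le1 rho y : density rho -> nu (outcome_prob H rho y) <= 1.
Proof.
by move=> rhoP; rewrite nu_le1 ?outcome_prob_ge0 ?outcome_prob_le1.
Qed.

Lemma mean_nu_ge0 th y : 0 <= mean_nu th y.
Proof.
apply: expect_ge0 => s; first exact: sample_prob_ge0 qP s.
by apply: nu_outcome_ge0; exact: density_sample_state.
Qed.

(** The set is bounded by 1, as an average of values of [nu] on [[0, 1]], so [sup] is a genuine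
    upper bound. *)
Lemma mean_nu_le_sup th y : mean_nu th y <= sup_mean_nu.
Proof.
apply: ub_le_sup; last by exists (th, y).
exists 1 => _ [[th' y'] _ <-] /=.
rewrite -(expect_cst 1 (sum_sample_prob qP)); apply: ler_expect => s.
  exact: sample_prob_ge0 qP s.
by apply: nu_outcome_le1; exact: density_sample_state.
Qed.

Lemma sup_mean_nu_ge0 : 0 <= sup_mean_nu.
Proof.
(* With no outcomes the index set is empty and the supremum takes its default value 0. *)
have [[[th y] _]|/set0P/negP/negPn/eqP S0] :=
  pselect ([set: 'rV[R]_D * 'I_Nh] !=set0).
  exact: le_trans (mean_nu_ge0 th y) (mean_nu_le_sup th y).
by rewrite /sup_mean_nu S0 image_set0 sup0.
Qed.

Lemma mean_obs_var_le th :
  expect W (fun s => obs_var H (state s th)) <= Nh%:R * obs_tr2 H * sup_mean_nu.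
Proof.
have le1 : expect W (fun s => obs_var H (state s th)) <=
    expect W (fun s =>
      Nh%:R * \sum_y obs_val H y ^+ 2 * nu (outcome_prob H (state s th) y)).
  apply: ler_expect => s; first exact: sample_prob_ge0 qP s.
  have sP := density_sample_state ns C eps01 s th.
  apply: finvar_le_nu => [y|]; [exact: outcome_prob_ge0 | exact: sum_outcome_prob].
apply: (le_trans le1); rewrite expectZ expect_sum -mulrA ler_wpM2l //.
apply: (@le_trans _ _ ((\sum_y obs_val H y ^+ 2) * sup_mean_nu)).
  rewrite mulr_suml; apply: ler_sum => y _; rewrite expectZ.
  by rewrite ler_wpM2l ?sqr_ge0 // mean_nu_le_sup.
by rewrite ler_wpM2r ?sup_mean_nu_ge0 ?obs_tr2_ge.
Qed.

Lemma finvar_sample_mean_le theta d :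
  finvar W (circuit_mean (sample_sgn q)
    (fun s d b => outcome_prob H (state s (Defs.shift theta d b)))
    (obs_val H) (qZ q) d) <= qZ q ^+ 2 * opnorm (obs_mx H) ^+ 2.
Proof.
apply: finvar_circuit_mean_le => [s|||s b].
- exact: sample_prob_ge0 qP s.
- exact: sum_sample_prob qP.
- exact: sample_prob_sgn2.
rewrite expect_outcome; apply: expval_le_opnorm.
exact: density_sample_state.
Qed.

Lemma qem_var_le theta Nm Nc :
    (0 < Nm)%N -> (0 < Nc)%N -> (Nc %| Nm)%N ->
  qem_var ns eps C H theta q Nc (Nm %/ Nc) <= V_qem ns eps C H q Nm Nc.
Proof.
move=> Nm0 Nc0 NcNm.
have M0 : (0 < Nm %/ Nc)%N by rewrite divn_gt0 // dvdn_leq.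
rewrite (qem_varE _ _ eps01 qP) // [(Nc * _)%N]mulnC divnK // /V_qem -/sup_mean_nu.
rewrite [leRHS]addrC; apply: lerD.
  rewrite mulrC ler_wpM2r ?invr_ge0 //.
  apply: (@le_trans _ _ (\sum_(d < D) qZ q ^+ 2 * opnorm (obs_mx H) ^+ 2)).
    by apply: ler_sum => d _; exact: finvar_sample_mean_le.
  by rewrite sumr_const card_ord -[(_ * _) *+ _]mulr_natr mulrAC.
(* Each component has two shifted settings with the same bound; this doubling turns the factor 1/4
   into the 1/2 of [V_qem]. *)
apply: (@le_trans _ _ ((4 * Nm%:R)^-1 * qZ q ^+ 2 *
    \sum_(d < D) (Nh%:R * obs_tr2 H * sup_mean_nu *+ 2))).
  have c0 : 0 <= (4 * Nm%:R)^-1 * qZ q ^+ 2.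
    by rewrite mulr_ge0 ?sqr_ge0 // invr_ge0 mulr_ge0.
  apply: (ler_wpM2l c0); apply: ler_sum => d _; rewrite expectD mulr2n.
  by apply: lerD; exact: mean_obs_var_le.
rewrite sumr_const card_ord -[_ *+ D]mulr_natl -[_ *+ 2]mulr_natl.
have Nm0' : Nm%:R != 0 :> R by rewrite pnatr_eq0 -lt0n.
move: (qZ q) (obs_tr2 H) sup_mean_nu => z t s.
rewrite le_eqVlt; apply/orP; left; apply/eqP; field.
by rewrite Nm0'.
Qed.

Lemma V_qem_circuit_ge (Nm Nc : nat) :
  (qZ q ^+ 2 * D%:R * opnorm (obs_mx H) ^+ 2 / Nc%:R) >=
  D%:R * opnorm (obs_mx H) ^+ 2 / Nc%:R.
Proof.
have Z1 : 1 <= qZ q ^+ 2 by rewrite expr2 mulr_ege1 // (qZ_ge1 qP).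
rewrite ler_wpM2r ?invr_ge0 // -[leRHS]mulrA ler_peMl // mulr_ge0 // sqr_ge0 //.
Qed.

Lemma qem_var_ge_shots theta Nm Nc :
    (0 < Nm)%N -> (0 < Nc)%N -> (Nc %| Nm)%N ->
  (4 * Nm%:R)^-1 * qZ q ^+ 2 * \sum_d expect W (fun s =>
      obs_var H (state s (Defs.shift theta d true))
      + obs_var H (state s (Defs.shift theta d false))) <=
  qem_var ns eps C H theta q Nc (Nm %/ Nc).
Proof.
move=> Nm0 Nc0 NcNm.
have M0 : (0 < Nm %/ Nc)%N by rewrite divn_gt0 // dvdn_leq.
rewrite (qem_varE _ _ eps01 qP) // [(Nc * _)%N]mulnC divnK // lerDr.
rewrite mulr_ge0 ?invr_ge0 // sumr_ge0 // => d _.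
by apply: finvar_ge0 => s; exact: sample_prob_ge0 qP s.
Qed.

Lemma qem_var_ge0 theta Nc M : (0 < Nc)%N -> (0 < M)%N ->
  0 <= qem_var ns eps C H theta q Nc M.
Proof.
move=> Nc0 M0; rewrite (qem_varE _ _ eps01 qP) //.
have W0 s : 0 <= W s by exact: sample_prob_ge0 qP s.
rewrite addr_ge0 //.
  by rewrite mulr_ge0 ?invr_ge0 // sumr_ge0 // => d _; exact: finvar_ge0.
rewrite mulr_ge0 //; first by rewrite mulr_ge0 ?sqr_ge0 // invr_ge0 mulr_ge0.
apply: sumr_ge0 => d _; apply: expect_ge0 => // s.
by apply: addr_ge0; apply: obs_var_ge0; exact: density_sample_state.
Qed.

Lemma obs_tr2_ge0 : 0 <= obs_tr2 H.
Proof.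
by apply: le_trans (obs_tr2_ge H); apply: sumr_ge0 => y _; exact: sqr_ge0.
Qed.

Lemma V_qem_ge Nm Nc :
  D%:R * opnorm (obs_mx H) ^+ 2 / Nc%:R <= V_qem ns eps C H q Nm Nc.
Proof.
apply: (le_trans (V_qem_circuit_ge Nm Nc)); rewrite /V_qem -/sup_mean_nu lerDr.
have tr0 := obs_tr2_ge0; have S0 := sup_mean_nu_ge0; have Z0 := sqr_ge0 (qZ q).
by apply: mulr_ge0 => //; apply: divr_ge0; do ?[apply: mulr_ge0 => //].
Qed.

(* With [|q d 0| >= 1], the sample consisting of identity strings only, whose
   state is the noisy state, has probability at least [Z^-2]. *)
Section IdentityWeight.
Hypothesis q_id : forall d, 1 <= `|q d (pauli_id n)|.

Lemma noisy_le_mean (f : 'M[R[i]]_(2 ^ n) -> R) th :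
    (forall rho, density rho -> 0 <= f rho) ->
  f (noisy_state ns eps C th) <= qZ q ^+ 2 * expect W (fun s => f (state s th)).
Proof.
move=> f0; rewrite noisy_state_sample; set s0 := [ffun=> _].
have fs s : 0 <= f (state s th) by apply: f0; exact: density_sample_state.
have Ws s : 0 <= W s by exact: sample_prob_ge0 qP s.
have Z1 := qZ_ge1 qP.
(* The normalizations cancel factor by factor, leaving the product of the [|q d 0|]; the second
   factor [Z] is bounded below by 1 separately. *)
have W1 : 1 <= qZ q * W s0.
  rewrite /qZ /sample_prob -big_split /=; elim/big_rec: _ => // d x _ x1.
  rewrite mulr_ege1 // ffunE mulrCA divff ?mulr1 ?q_id //.
  by rewrite gt_eqF // (qZ1_gt0 qP).
apply: (@le_trans _ _ (qZ q ^+ 2 * (W s0 * f (state s0 th)))); last first.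
  rewrite ler_wpM2l ?sqr_ge0 // /expect (bigD1 s0) //= lerDl sumr_ge0 // => s _.
  by rewrite mulr_ge0.
move: (fs s0) Z1 W1; move: (f _) (qZ q) (W s0) => x z w x0 z1 w1.
rewrite expr2 (_ : z * z * (w * x) = (z * (z * w)) * x); last by ring.
by rewrite ler_peMl // mulr_ege1.
Qed.

Lemma noisy_var_le_qem_var theta Nm Nc :
    (0 < Nm)%N -> (0 < Nc)%N -> (Nc %| Nm)%N ->
  noisy_var ns eps C H theta Nm <= qem_var ns eps C H theta q Nc (Nm %/ Nc).
Proof.
move=> Nm0 Nc0 NcNm; apply: le_trans (qem_var_ge_shots theta Nm0 Nc0 NcNm).
rewrite noisy_varE // -[leRHS]mulrA.
have c0 : 0 <= (4 * Nm%:R : R)^-1 by rewrite invr_ge0 mulr_ge0.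
apply: (ler_wpM2l c0); rewrite mulr_sumr; apply: ler_sum => d _.
rewrite expectD mulrDr; apply: lerD; apply: noisy_le_mean; exact: obs_var_ge0.
Qed.

(** At each fixed parameter and outcome, [nu] of the noisy probability is at most [Z ^ 2] times its
    sample mean; the bound survives the supremum and the finite maximum. *)
Lemma V_noisy_le Nm Nc :
  V_noisy ns eps C H Nm + D%:R * opnorm (obs_mx H) ^+ 2 / Nc%:R <=
    V_qem ns eps C H q Nm Nc.
Proof.
rewrite /V_qem -/sup_mean_nu; apply: lerD; last exact: V_qem_circuit_ge.
have maxE : \big[Num.max/0]_(y < Nh)
    sup [set nu (outcome_prob H (noisy_state ns eps C th) y) | th in setT] <=
    qZ q ^+ 2 * sup_mean_nu.
  apply: bigmax_le => [|y _]; first by rewrite mulr_ge0 ?sqr_ge0 ?sup_mean_nu_ge0.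
  apply: ge_sup.
    by exists (nu (outcome_prob H (noisy_state ns eps C 0) y)), 0.
  move=> _ [th _ <-].
  apply: (@le_trans _ _ (qZ q ^+ 2 * mean_nu th y)).
    apply: (@noisy_le_mean (fun rho => nu (outcome_prob H rho y))).
    by move=> rho; exact: nu_outcome_ge0.
  by rewrite ler_wpM2l ?sqr_ge0 ?mean_nu_le_sup.
have c0 : 0 <= D%:R * Nh%:R * obs_tr2 H / (2 * Nm%:R).
  have tr0 := obs_tr2_ge0.
  by apply: divr_ge0; do ?[apply: mulr_ge0 => //].
rewrite /V_noisy; apply: (le_trans (ler_wpM2l c0 maxE)).
move: (obs_tr2 H) sup_mean_nu (qZ q) => t s z.
by rewrite le_eqVlt; apply/orP; left; apply/eqP; ring.
Qed.

End IdentityWeight.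

(** Without qubits there is no non-identity string, and the noise probabilities would sum to 0
    instead of 1. *)
Lemma depolarizing_qubit : depolarizing ns -> (0 < n)%N.
Proof.
case=> suppE _; rewrite lt0n; apply/negP => /eqP n0.
have := noise_prob_sum1 ns; rewrite big1 => [/eqP|s].
  by rewrite eq_sym oner_eq0.
rewrite suppE inE => /eqP; case; apply/eq_from_tnth => i.
by have := ltn_ord i; rewrite [X in (_ < X)%N]n0.
Qed.

(* The trace and the supertrace of the representation at a fixed gate give two
   linear equations for [q d 0]. *)
Lemma depolarizing_q_id d : depolarizing ns -> 1 <= `|q d (pauli_id n)|.
Proof.
move=> depol; have n0 := depolarizing_qubit depol; case: depol => suppE probE.
have := sum_quasi_prob_weight qP d; have := sum_quasi_prob qP d.
have N4 : 4 <= 4 ^+ n :> R.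
  by rewrite -(prednK n0) exprS ler_peMr // exprn_ege1 // ler1n.
move: probE eps01; set N := 4 ^+ n in N4 * => probE /andP[e0 e1].
rewrite (bigD1 (pauli_id n)) //= => q1.
rewrite (bigD1 (pauli_id n)) //= {1}/noise_weight eqxx.
rewrite (eq_bigr (fun s => q d s * (eps * (N - 1)^-1))); last first.
  by move=> s sn; rewrite noise_weight_supp ?probE // suppE inE.
rewrite -mulr_suml; move: q1; clear suppE probE n0.
move: (\sum_(i | _) _) (q d _) => x y xy.
have N1 : N - 1 != 0 by apply/eqP => N1; lra.
have := mulfVK N1 eps; move: (eps / (N - 1)) => u uE yx.
(* Here [y] is the identity quasi-probability and [x] the sum of the others; [x] is eliminated
   without dividing by [N - 1 - N * eps], which may vanish a priori. *)
have eqy : y * (N - 1 - N * eps) = N - 1 - eps.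
  transitivity ((y * (1 - eps) + x * u) * (N - 1) - eps); last by rewrite yx mul1r.
  by rewrite mulrDl -[x * u * _]mulrA uE (_ : x = 1 - y); [ring | lra].
have Ne4 : 4 * eps <= N * eps by rewrite ler_wpM2r.
have NeN : N * eps <= N by rewrite ler_piMr //; lra.
have pos : 0 < N - 1 - eps by lra.
rewrite leNgt; apply/negP => y1.
(* This contradicts [N >= 4] and [0 <= eps <= 1]: a nonnegative [N - 1 - N * eps] is at most
   [N - 1 - eps], and a negative one has absolute value at most 1. *)
have : `|N - 1 - eps| < `|N - 1 - N * eps|.
  rewrite -eqy normrM gtr_pMl // normr_gt0; apply/eqP => a0.
  by move: pos; rewrite -eqy a0 mulr0 ltxx.
rewrite gtr0_norm //; case: (ger0P (N - 1 - N * eps)) => ?; lra.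
Qed.

End Bounds.

Theorem theorem5p1 (R : realType) (n D : nat) (ns : pauli_noise R n) :
  exists c1 c2 : R -> R,
    (forall g : R, 0 <= g <= 1 -> 0 <= c1 g /\ 1 <= c2 g) /\
    (forall (eps : R) (C : circuit R n D) (Nh : nat) (H : observable R n Nh)
            (q : 'I_D -> pauli_index n -> R) (Nm Nc : nat) (theta : 'rV[R]_D),
        0 <= eps <= 1 ->
        quasi_prob_repr ns eps C q ->
        (0 < Nm)%N -> (0 < Nc)%N -> (Nc %| Nm)%N ->
        let g := noise_level (D := D) eps in
        c1 g * noisy_var ns eps C H theta Nm
          <= qem_var ns eps C H theta q Nc (Nm %/ Nc)
          <= V_qem ns eps C H q Nm Nc
        /\ V_qem ns eps C H q Nm Nc
           >= c1 g * V_noisy ns eps C H Nm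
              + c2 g * D%:R * opnorm (obs_mx H) ^+ 2 / Nc%:R) /\
    (depolarizing ns ->
      (forall g : R, 0 <= g <= 1 -> 1 <= c1 g) /\
      (forall g g' : R, 0 <= g -> g <= g' -> g' <= 1 ->
         c1 g <= c1 g' /\ c2 g <= c2 g') /\
      c1 0 = 1 /\ c2 0 = 1).
Proof.
(* The constant is 1 for depolarizing noise and 0 otherwise; both witnesses are constant functions,
   so monotonicity is immediate. *)
pose c := (`[< depolarizing ns >])%:R : R.
exists (fun=> c), (fun=> 1); split; first by move=> g _; rewrite /c ler0n.
split; last by move=> /asboolT depol; rewrite /c depol.
move=> eps C Nh H q Nm Nc theta eps01 qP Nm0 Nc0 NcNm g.
have M0 : (0 < Nm %/ Nc)%N by rewrite divn_gt0 // dvdn_leq.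
rewrite (qem_var_le H eps01 qP theta Nm0 Nc0 NcNm) andbT mul1r /c.
case: asboolP => [depol|_]; last first.
  rewrite !mul0r add0r; split; first exact: qem_var_ge0.
  exact: V_qem_ge eps01 qP Nm Nc.
have q_id d : 1 <= `|q d (pauli_id n)| by exact: depolarizing_q_id eps01 qP d depol.
rewrite !mul1r; split; first exact: noisy_var_le_qem_var.
exact: V_noisy_le eps01 qP q_id Nm Nc.
Qed.
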